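(* Let $a_3(n)$ be defined by \[\sum_{n\geq 0}a_3(n)q^n=\frac{f_3f_6}{f_1f_2},\qquad f_k=\prod_{m=1}^{\infty}(1-q^{km}).\] Then for every integer $\alpha\geq 0$ and every integer $n\geq 0$, \begin{align*} a_3\left(3^{2\alpha}n+\frac{3^{2\alpha}-1}{4}\right)&\equiv 0 \pmod{3^{\alpha}},\\ a_3\left(3^{2\alpha+1}n+\frac{3^{2\alpha+2}-1}{4}\right)&\equiv 0 \pmod{3^{\alpha+1}},\\ a_3\left(3^{2\alpha+2}n+\frac{7\cdot 3^{2\alpha+1}-1}{4}\right)&\equiv 0 \pmod{3^{\alpha+2}},\\ a_3\left(3^{2\alpha+2}n+\frac{11\cdot 3^{2\alpha+1}-1}{4}\right)&\equiv 0 \pmod{3^{\alpha+2}}. \end{align*}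
   Context: $a_3(n)$ is the number of 3-regular cubic partitions of $n$; its generating function is as given, where $f_k=(q^k;q^k)_\infty$. *)

(* Defs.v *)
From HB Require Import structures.
From mathcomp Require Import all_boot all_order all_algebra.
Set Implicit Arguments. Unset Strict Implicit. Unset Printing Implicit Defensive.
Import Order.TTheory GRing.Theory Num.Theory.
Local Open Scope ring_scope.

(* Truncation of f_k = prod_{m>=1} (1 - q^{k m}) to the factors m = 1..N.
   For N >= n (and k >= 1) its coefficient of q^n equals that of f_k. *)
Definition fk (k N : nat) : {poly int} :=
  \prod_(1 <= m < N.+1) (1 - 'X^(k * m)).

Definition ser (a : nat -> int) (N : nat) : {poly int} :=
  \poly_(i < N.+1) a i.

(* a is the coefficient sequence of f3 f6 / (f1 f2), i.e.
   (sum a(n) q^n) * f1 * f2 = f3 * f6 as formal power series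
   (compared coefficientwise; f1 f2 has constant term 1, so a is unique). *)
Definition is_a3 (a : nat -> int) : Prop :=
  forall n : nat, (ser a n * fk 1 n * fk 2 n)`_n = (fk 3 n * fk 6 n)`_n.

(* Main.v *)
(* Write f1 f2 = psi(q) phi(-q).  Trisecting the two theta series and using the
   Jacobi triple product gives
     f1 f2 = A(q^3) - q f9 f18 - q^2 B(q^3),   A B = 2 (f3 f6)^2,
   while multiplying over the three cube roots of unity gives the norm of f1 f2,
   namely (f3 f6)^4 / (f9 f18).  Let G = f3 f6 / (f1 f2) be the generating series
   of a_3, t = q G^4 and s = q G(q) G(q^3).  These facts amount to the modular
   equation s^3 = t(q^3) (1 + 3 s + 9 s^2), together with U s = 3 t and
   U s^2 = 2 t + 27 t^2, where U keeps the exponents divisible by 3.  So U s^i is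
   an integer polynomial in t, whose coefficients have 3-adic valuations bounded
   below by the recursion.  As G t^j and G^3 t^j are s^(4j+1) and s^(4j+3) up to a
   series in q^3, alternately extracting the exponents 2 and 0 modulo 3 maps
   G P(t) to 3 G^3 Q(t) and back to 3 G R(t), preserving the invariant that 27^j
   divides 3 times the coefficient of t^j.  The last two congruences hold because
   G^3 is a series in q^3 modulo 3. *)
Require Import Defs.
From HB Require Import structures.
From mathcomp Require Import all_boot all_order all_algebra.
From mathcomp Require Import boolp.
From mathcomp Require Import ring zify.
Import Order.TTheory GRing.Theory Num.Theory.
Local Open Scope ring_scope.
Set Implicit Arguments. Unset Strict Implicit. Unset Printing Implicit Defensive.

(** * Formal power series *)

Record fps (R : Type) := Fps { coeff : nat -> R }.
Notation "a $ n" := (coeff a n) (at level 2, n at level 2, format "a $ n").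

HB.instance Definition _ (R : Type) := gen_eqMixin (fps R).
HB.instance Definition _ (R : Type) := gen_choiceMixin (fps R).

Lemma fpsP (R : Type) (a b : fps R) : (forall n, a$n = b$n) -> a = b.
Proof. by case: a b => [a] [b] /= /funext ->. Qed.

Section FpsRing.
Variable R : comNzRingType.
Implicit Types a b c : fps R.

Definition fps_zero : fps R := Fps (fun=> 0).
Definition fps_opp a : fps R := Fps (fun n => - a$n).
Definition fps_add a b : fps R := Fps (fun n => a$n + b$n).
Definition fps_one : fps R := Fps (fun n => (n == 0)%:R).
(** Locked so that simplification does not expand products into convolution sums. *)
Definition fps_mul : fps R -> fps R -> fps R :=
  locked (fun a b => Fps (fun n => \sum_(i < n.+1) a$i * b$(n - i))).

Fact fps_addA : associative fps_add.
Proof. by move=> a b c; apply: fpsP => n /=; rewrite addrA. Qed.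
Fact fps_addC : commutative fps_add.
Proof. by move=> a b; apply: fpsP => n /=; rewrite addrC. Qed.
Fact fps_add0 : left_id fps_zero fps_add.
Proof. by move=> a; apply: fpsP => n /=; rewrite add0r. Qed.
Fact fps_addN : left_inverse fps_zero fps_opp fps_add.
Proof. by move=> a; apply: fpsP => n /=; rewrite addNr. Qed.

HB.instance Definition _ :=
  GRing.isZmodule.Build (fps R) fps_addA fps_addC fps_add0 fps_addN.

Definition fps_trunc (N : nat) a : {poly R} := \poly_(i < N) a$i.

Lemma fps_mulE a b n : (fps_mul a b)$n = \sum_(i < n.+1) a$i * b$(n - i).
Proof. by rewrite /fps_mul -lock. Qed.

(** The coefficient involves indices up to n only, so the ring laws are inherited from truncations,
    which are polynomials. *)
Lemma fps_mul_trunc N a b n : (n < N)%N ->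
  (fps_mul a b)$n = (fps_trunc N a * fps_trunc N b)`_n.
Proof.
move=> nN; rewrite coefM fps_mulE; apply: eq_bigr => i _; rewrite !coef_poly.
by rewrite (leq_ltn_trans _ nN) ?(leq_ltn_trans _ nN) ?leq_subr // -ltnS.
Qed.

Fact fps_mulC : commutative fps_mul.
Proof.
by move=> a b; apply: fpsP => n; rewrite !(@fps_mul_trunc n.+1) // mulrC.
Qed.
Fact fps_mulA : associative fps_mul.
Proof.
move=> a b c; apply: fpsP => n.
have -> : (fps_mul a (fps_mul b c))$n =
    (fps_trunc n.+1 a * (fps_trunc n.+1 b * fps_trunc n.+1 c))`_n.
  rewrite coefM fps_mulE; apply: eq_bigr => i _; rewrite coef_poly ltn_ord.
  by rewrite -fps_mul_trunc // ltnS leq_subr.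
rewrite mulrA coefM fps_mulE; apply: eq_bigr => i _.
by rewrite -fps_mul_trunc // coef_poly ltnS leq_subr.
Qed.
Fact fps_mul1 : left_id fps_one fps_mul.
Proof.
move=> a; apply: fpsP => n; rewrite fps_mulE big_ord_recl /= mul1r subn0 big1 ?addr0 //.
by move=> i _; rewrite mul0r.
Qed.
Fact fps_mulDl : left_distributive fps_mul +%R.
Proof.
move=> a b c; apply: fpsP => n; rewrite /= !fps_mulE -big_split /=.
by apply: eq_bigr => i _; rewrite mulrDl.
Qed.
Fact fps_one_neq0 : fps_one != 0.
Proof. by apply/eqP => /(congr1 (fun a => a$0)) /eqP; rewrite oner_eq0. Qed.

HB.instance Definition _ := GRing.Zmodule_isComNzRing.Build (fps R)
  fps_mulA fps_mulC fps_mul1 fps_mulDl fps_one_neq0.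

Lemma coeffD a b n : (a + b)$n = a$n + b$n. Proof. by []. Qed.
Lemma coeffN a n : (- a)$n = - a$n. Proof. by []. Qed.

Lemma coeff1 n : (1 : fps R)$n = (n == 0)%:R. Proof. by []. Qed.
Lemma coeffM a b n : (a * b)$n = \sum_(i < n.+1) a$i * b$(n - i).
Proof. exact: fps_mulE. Qed.

Lemma coeffMn a m n : (a *+ m)$n = a$n *+ m.
Proof. by elim: m => // m IH; rewrite !mulrS coeffD IH. Qed.

Definition fpsX : fps R := Fps (fun n => (n == 1)%:R).
Local Notation q := fpsX.

Lemma coeffXM a n : (q * a)$n = if n is m.+1 then a$m else 0.
Proof.
case: n => [|n]; rewrite coeffM big_ord_recl /= mul0r add0r ?big_ord0 //.
rewrite big_ord_recl /= mul1r /bump /= add1n subn1 /= big1 ?addr0 //.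
by move=> i _; rewrite mul0r.
Qed.

Lemma coeffXnM k a n : (q ^+ k * a)$n = if (n < k)%N then 0 else a$(n - k).
Proof.
elim: k n => [|k IH] n; first by rewrite mul1r subn0.
by rewrite exprS -mulrA coeffXM; case: n => [|n] //; rewrite IH.
Qed.

Lemma coeffXn k n : (q ^+ k)$n = (n == k)%:R.
Proof.
rewrite -[_ ^+ _]mulr1 coeffXnM coeff1 subn_eq0.
by case: ltngtP.
Qed.

(** * Congruence modulo powers of q and q-adic convergence *)

Definition eqm (M : nat) a b := forall n, (n < M)%N -> a$n = b$n.

Lemma eqm_sym M a b : eqm M a b -> eqm M b a.
Proof. by move=> ab n /ab ->. Qed.
Lemma eqm_trans M b a c : eqm M a b -> eqm M b c -> eqm M a c.
Proof. by move=> ab bc n nM; rewrite ab ?bc. Qed.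
Lemma eqm_le N M a b : (M <= N)%N -> eqm N a b -> eqm M a b.
Proof. by move=> MN ab n nM; apply: ab; apply: leq_trans MN. Qed.
Lemma eqmD M a b c d : eqm M a b -> eqm M c d -> eqm M (a + c) (b + d).
Proof. by move=> ab cd n nM; rewrite !coeffD ab ?cd. Qed.
Lemma eqmM M a b c d : eqm M a b -> eqm M c d -> eqm M (a * c) (b * d).
Proof.
move=> ab cd n nM; rewrite !coeffM; apply: eq_bigr => i _.
by rewrite ab ?cd ?(leq_ltn_trans _ nM) ?leq_subr // -ltnS.
Qed.
Lemma eqm_sum M I (r : seq I) (P : pred I) (F F' : I -> fps R) :
  (forall i, P i -> eqm M (F i) (F' i)) ->
  eqm M (\sum_(i <- r | P i) F i) (\sum_(i <- r | P i) F' i).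
Proof.
by move=> FF; elim/big_ind2: _ => // *; apply: eqmD.
Qed.
Lemma eqm0Ml M a b : eqm M a 0 -> eqm M (a * b) 0.
Proof. by move=> a0; rewrite -[0](mul0r b); apply: eqmM. Qed.

Lemma eqm_expr Q k : Q$0 = 0 -> eqm k (Q ^+ k) 0.
Proof.
move=> Q0; have -> : Q = q * Fps (fun n => Q$n.+1).
  by apply: fpsP => -[|n]; rewrite coeffXM.
by rewrite exprMn => n nk; rewrite coeffXnM nk.
Qed.

(** The constant term 1 determines the coefficients of the cofactor one by one over any commutative
    ring. The regularity that follows replaces division of series below. *)
Lemma eqm_cancel M a b c : a$0 = 1 -> eqm M (a * b) (a * c) -> eqm M b c.
Proof.
move=> a0 abc n; elim/ltn_ind: n => n IH nM; move: (abc n nM).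
rewrite !coeffM !big_ord_recl /= a0 !mul1r subn0.
rewrite (eq_bigr (fun i : 'I_n => a$(bump 0 i) * c$(n - bump 0 i))) => [/addIr //|].
move=> i _; have lt_i : (n - bump 0 i < n)%N by have := ltn_ord i; rewrite /bump; lia.
by rewrite IH // (ltn_trans lt_i).
Qed.

Lemma fps_lreg a : a$0 = 1 -> GRing.lreg a.
Proof.
move=> a0 b c abc; apply: fpsP => n.
by apply: (@eqm_cancel n.+1 a b c) => // m _; rewrite abc.
Qed.

Lemma fpsX_lreg : GRing.lreg q.
Proof.
by move=> a b ab; apply: fpsP => n; move/(congr1 (fun c => c$(n.+1))): ab; rewrite !coeffXM.
Qed.

Definition cvg (u : nat -> fps R) a :=
  forall M, exists N0, forall N, (N0 <= N)%N -> eqm M (u N) a.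

Lemma cvg_unique u a b : cvg u a -> cvg u b -> a = b.
Proof.
move=> ua ub; apply: fpsP => n.
have [N1 h1] := ua n.+1; have [N2 h2] := ub n.+1.
by rewrite -(h1 (N1 + N2)%N) ?leq_addr // h2 ?leq_addl.
Qed.
Lemma cvg_ext u v a : u =1 v -> cvg u a -> cvg v a.
Proof.
by move=> uv ua M; have [N0 h] := ua M; exists N0 => N /h; rewrite uv.
Qed.
Lemma cvg_cst a : cvg (fun=> a) a.
Proof. by move=> M; exists 0%N. Qed.
Lemma cvgD u v a b : cvg u a -> cvg v b -> cvg (fun N => u N + v N) (a + b).
Proof.
move=> ua vb M; have [N1 h1] := ua M; have [N2 h2] := vb M.
exists (N1 + N2)%N => N hN.
by apply: eqmD; [apply: h1 | apply: h2]; apply: leq_trans hN; rewrite ?leq_addr ?leq_addl.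
Qed.
Lemma cvgM u v a b : cvg u a -> cvg v b -> cvg (fun N => u N * v N) (a * b).
Proof.
move=> ua vb M; have [N1 h1] := ua M; have [N2 h2] := vb M.
exists (N1 + N2)%N => N hN.
by apply: eqmM; [apply: h1 | apply: h2]; apply: leq_trans hN; rewrite ?leq_addr ?leq_addl.
Qed.
Lemma cvg_subseq u a (h : nat -> nat) :
  (forall N, (N <= h N)%N) -> cvg u a -> cvg (u \o h) a.
Proof.
move=> hN ua M; have [N0 uN] := ua M; exists N0 => N N0N.
by apply: uN; apply: leq_trans N0N _.
Qed.

(** When terms N and N+1 always agree modulo q^N, coefficient n is stable from term n+1 on. *)
Definition fps_lim (u : nat -> fps R) : fps R := Fps (fun n => (u n.+1)$n).
Lemma cvg_lim u : (forall N, eqm N (u N.+1) (u N)) -> cvg u (fps_lim u).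
Proof.
move=> uS M; exists M => N MN n nM /=.
have {MN nM} : (n < N)%N by apply: leq_trans MN.
elim: N => // N IH; rewrite ltnS leq_eqVlt => /orP[/eqP <- //|nN].
by rewrite uS // IH.
Qed.

End FpsRing.

(** * Infinite products and the Jacobi triple product *)

Section Products.
Variable R : comNzRingType.
Implicit Types a b x y Q : fps R.

(** In standard notation this is (-a; Q)_N, and [qinf a Q] is its limit for N to infinity. *)
Definition qpoch (N : nat) a Q : fps R := \prod_(i < N) (1 + a * Q ^+ i).
Definition qinf a Q : fps R := locked (fps_lim (fun N => qpoch N a Q)).

Lemma qpochS N a Q : qpoch N.+1 a Q = qpoch N a Q * (1 + a * Q ^+ N).
Proof. by rewrite /qpoch big_ord_recr. Qed.

Lemma qpochNS N a Q : qpoch N.+1 (- a) Q = qpoch N (- a) Q * (1 - a * Q ^+ N).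
Proof. by rewrite qpochS mulNr. Qed.

Lemma qpochSl N a Q : qpoch N.+1 a Q = (1 + a) * qpoch N (a * Q) Q.
Proof.
rewrite /qpoch big_ord_recl mulr1; congr (_ * _); apply: eq_bigr => i _.
by rewrite exprS mulrA.
Qed.

Lemma cvg_qinf a Q : Q$0 = 0 -> cvg (fun N => qpoch N a Q) (qinf a Q).
Proof.
move=> Q0; rewrite /qinf -lock; apply: cvg_lim => N;
  rewrite qpochS mulrDr mulr1 -[X in eqm _ _ X]addr0.
apply: eqmD => //; rewrite mulrA mulrC; apply: eqm0Ml; exact: eqm_expr.
Qed.

Lemma coeff0M a b : (a * b)$0 = a$0 * b$0.
Proof. by rewrite coeffM big_ord_recl big_ord0 addr0. Qed.

Lemma coeff0X a k : (a ^+ k)$0 = a$0 ^+ k.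
Proof. by elim: k => // k IH; rewrite !exprS coeff0M IH. Qed.

Lemma qinf_coeff0 a Q : a$0 = 0 -> (qinf a Q)$0 = 1.
Proof.
by move=> a0; rewrite /qinf -lock /= /qpoch big_ord1 mulr1 coeffD a0 addr0.
Qed.

Lemma qinf_peel a Q : Q$0 = 0 -> qinf a Q = (1 + a) * qinf (a * Q) Q.
Proof.
move=> Q0; apply: (@cvg_unique _ (fun N => qpoch N.+1 a Q)).
  exact: (cvg_subseq (h := succn)) leqnSn (cvg_qinf a Q0).
apply: (cvg_ext (fun N => esym (qpochSl N a Q))).
by apply: cvgM; [apply: cvg_cst | apply: cvg_qinf].
Qed.

Lemma qinf_split2 a Q : Q$0 = 0 ->
  qinf a Q = qinf a (Q ^+ 2) * qinf (a * Q) (Q ^+ 2).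
Proof.
move=> Q0; have Q20 : (Q ^+ 2)$0 = 0 by rewrite coeff0X Q0 expr0n.
apply: (@cvg_unique _ (fun N => qpoch (2 * N) a Q)).
  by apply: (cvg_subseq (h := muln 2)) _ (cvg_qinf a Q0) => N; lia.
apply: cvg_ext (cvgM (cvg_qinf a Q20) (cvg_qinf (a * Q) Q20)) => N.
elim: N => [|N IH]; first by rewrite /qpoch !big_ord0 mulr1.
rewrite (_ : (2 * N.+1 = (2 * N).+2)%N); last by lia.
by rewrite !qpochS -IH -!exprM [Q ^+ (2 * N).+1]exprS; ring.
Qed.

Lemma qinf_split3 a Q : Q$0 = 0 ->
  qinf a Q = qinf a (Q ^+ 3) * qinf (a * Q) (Q ^+ 3) * qinf (a * Q ^+ 2) (Q ^+ 3).
Proof.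
move=> Q0; have Q30 : (Q ^+ 3)$0 = 0 by rewrite coeff0X Q0 expr0n.
apply: (@cvg_unique _ (fun N => qpoch (3 * N) a Q)).
  by apply: (cvg_subseq (h := muln 3)) _ (cvg_qinf a Q0) => N; lia.
apply: cvg_ext (cvgM (cvgM (cvg_qinf a Q30) (cvg_qinf (a * Q) Q30))
  (cvg_qinf (a * Q ^+ 2) Q30)) => N.
elim: N => [|N IH]; first by rewrite /qpoch !big_ord0 !mulr1.
rewrite (_ : (3 * N.+1 = (3 * N).+3)%N); last by lia.
by rewrite !qpochS -IH -!exprM [Q ^+ (3 * N).+2]exprS [Q ^+ (3 * N).+1]exprS; ring.
Qed.

Lemma qinf_sqr a Q : Q$0 = 0 -> qinf a Q * qinf (- a) Q = qinf (- a ^+ 2) (Q ^+ 2).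
Proof.
move=> Q0; have Q20 : (Q ^+ 2)$0 = 0 by rewrite coeff0X Q0 expr0n.
apply: (cvg_unique _ (cvg_qinf _ Q20)).
apply: cvg_ext (cvgM (cvg_qinf a Q0) (cvg_qinf (- a) Q0)) => N.
elim: N => [|N IH]; first by rewrite /qpoch !big_ord0 !mulr1.
by rewrite !qpochS -IH -!exprM mulnC exprM; ring.
Qed.

(** * Theta series and their product formula *)

Definition triangular (k : nat) := 'C(k.+1, 2).

Lemma triS k : triangular k.+1 = (k.+1 + triangular k)%N.
Proof. by rewrite /triangular binS bin1 addnC. Qed.

Lemma tri_ge k : (k <= triangular k)%N.
Proof. by case: k => // k; rewrite triS leq_addr. Qed.

Lemma triE k : (triangular k * 2 = k * k.+1)%N.
Proof. by elim: k => // k; rewrite triS; nia. Qed.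

(* [tterm k x y + tterm k y x] collects the indices [k] and [-k] of Ramanujan's
   [f(x, y) = \sum_k x^(k(k+1)/2) y^(k(k-1)/2)]. *)
Definition tterm (k : nat) x y : fps R := x ^+ triangular k * y ^+ triangular k.-1.
Definition tsum (N : nat) x y : fps R :=
  1 + \sum_(k < N) (tterm k.+1 x y + tterm k.+1 y x).
Definition theta x y : fps R := locked (fps_lim (fun N => tsum N x y)).

Lemma tterm0 x y : tterm 0 x y = 1.
Proof. by rewrite /tterm /triangular bin_small // !expr0 mulr1. Qed.

Lemma tterm1 x y : tterm 1 x y = x.
Proof. by rewrite /tterm /triangular binn bin_small // expr0 mulr1. Qed.

(** [tterm k.+1 x y] is x^(k+1) (x y)^(k(k+1)/2), and the second factor has order at least k.
    Smallness is asked of the product x y, so that x = 1 is allowed for 2 psi(q). *)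
Lemma tterm_eqm0 M k x y : (x * y)$0 = 0 -> (M < k)%N -> eqm M (tterm k x y) 0.
Proof.
case: k => // k xy0; rewrite ltnS => Mk; rewrite /tterm /= triS.
apply: (eqm_le (leq_trans Mk (tri_ge k))).
rewrite addnC exprD mulrAC -exprMn; apply: eqm0Ml; exact: eqm_expr.
Qed.

Lemma cvg_theta x y : (x * y)$0 = 0 -> cvg (fun N => tsum N x y) (theta x y).
Proof.
move=> xy0; rewrite /theta -lock; apply: cvg_lim => N; rewrite /tsum big_ord_recr /= addrA.
rewrite -[X in eqm _ _ X]addr0; apply: eqmD => //; rewrite -[0]addr0.
by apply: eqmD; apply: tterm_eqm0; rewrite ?ltnS // mulrC.
Qed.

Lemma theta_sym x y : theta x y = theta y x.
Proof.
rewrite /theta -!lock; apply: fpsP => n /=; rewrite /tsum; congr ((1 + _)$n); apply: eq_bigr => i _.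
exact: addrC.
Qed.

(* [gbin Q N k] is the Gaussian binomial coefficient [2N, N + k]. *)
Fixpoint gbin Q (N k : nat) : fps R :=
  if N is N'.+1 then
    if k is k'.+1 then
      if (k' < N')%N then
        (1 + Q ^+ (2 * N').+1) * gbin Q N' k + Q ^+ (N' - k') * gbin Q N' k'
          + Q ^+ (N' + k).+1 * gbin Q N' k.+1
      else (k' == N')%:R
    else (1 + Q ^+ (2 * N').+1) * gbin Q N' 0 + (Q ^+ N'.+1 * gbin Q N' 1) *+ 2
  else (k == 0)%:R.

Lemma gbin_gt Q N k : (N < k)%N -> gbin Q N k = 0.
Proof.
case: N k => [|N] [|k] //=; rewrite ltnS => Nk.
by rewrite ltnNge ltnW //= gtn_eqF.
Qed.

(** The factorial formula [2N, N+k] = (Q)_2N / ((Q)_(N-k) (Q)_(N+k)) with denominators cleared. The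
    recursion of [gbin] is the q-Pascal rule applied twice; its doubled term at k = 0 reflects the
    symmetry under k to -k. *)
Lemma gbin_qpoch Q N k : (k <= N)%N ->
  gbin Q N k * qpoch (N - k) (- Q) Q * qpoch (N + k) (- Q) Q = qpoch (2 * N) (- Q) Q.
Proof.
have P0 : qpoch 0 (- Q) Q = 1 by rewrite /qpoch big_ord0.
elim: N k => [|N IH] k; first by rewrite leqn0 => /eqP ->; rewrite !P0 !mulr1.
have step2 : qpoch (2 * N.+1) (- Q) Q =
    qpoch (2 * N) (- Q) Q * (1 - Q * Q ^+ (2 * N)) * (1 - Q * Q ^+ (2 * N).+1).
  by rewrite (_ : (2 * N.+1 = (2 * N).+2)%N) ?qpochNS //; lia.
case: k => [|k].
  move=> _; rewrite subn0 addn0 /= step2.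
  have h0 := IH 0%N isT; rewrite subn0 addn0 in h0.
  have h1 : gbin Q N 1 * qpoch N.+1 (- Q) Q * qpoch N.+1 (- Q) Q =
      (1 - Q ^+ N) * (1 - Q * Q ^+ N) * qpoch (2 * N) (- Q) Q.
    case: N IH {step2 h0} => [|N] IH; first by rewrite gbin_gt // subrr !mul0r.
    by rewrite -(IH 1%N) // subSS subn0 addn1 2!qpochNS exprS; ring.
  rewrite mulrDl mulrDl mulrnAl mulrnAl -2!mulrA [_ * (qpoch _ _ _ * _)]mulrA.
  rewrite -(mulrA (Q ^+ N.+1)) -(mulrA (Q ^+ N.+1)) h1 qpochS.
  transitivity ((1 + Q ^+ (2 * N).+1) * (gbin Q N 0 * qpoch N (- Q) Q * qpoch N (- Q) Q)
     * (1 - Q * Q ^+ N) ^+ 2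
     + Q ^+ N.+1 * ((1 - Q ^+ N) * (1 - Q * Q ^+ N) * qpoch (2 * N) (- Q) Q) *+ 2).
    by ring.
  by rewrite h0 !exprS mulnC exprM; ring.
rewrite ltnS leq_eqVlt => /orP[/eqP ->|kN].
  rewrite subnn P0 mulr1 /= ltnn eqxx mul1r; congr (qpoch _ _ _); lia.
rewrite subSS [gbin _ _ _]/= kN.
have [m Nm] : exists m, (N - k = m.+1)%N by exists (N - k.+1)%N; lia.
rewrite Nm [qpoch (N.+1 + _) _ _](_ : _ = qpoch (N + k).+2 (- Q) Q); last first.
  by congr qpoch; lia.
have h0 := IH k (ltnW kN); rewrite Nm in h0.
have h1 := IH k.+1 kN; rewrite (_ : (N - k.+1 = m)%N) ?addnS in h1; last by lia.
have h2 : gbin Q N k.+2 * qpoch m (- Q) Q * qpoch (N + k).+2 (- Q) Q =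
    (1 - Q ^+ m) * qpoch (2 * N) (- Q) Q.
  case: m Nm {h0 h1} => [|m] Nm; first by rewrite gbin_gt ?subrr ?mul0r //; lia.
  rewrite -(IH k.+2); last by lia.
  have -> : (N - k.+2 = m)%N by lia.
  rewrite !addnS.
  by rewrite (qpochNS m) exprS; ring.
have hp : Q ^+ (2 * N) = Q ^+ m * Q ^+ (N + k).+1 by rewrite -exprD; congr (_ ^+ _); lia.
have hb : Q ^+ (N + k.+1).+1 = Q * Q ^+ (N + k).+1 by rewrite addnS exprS.
rewrite hb [Q ^+ (2 * N).+1]exprS step2 [Q ^+ (2 * N).+1]exprS hp [Q ^+ m.+1]exprS.
have e1 : qpoch (N + k).+1 (- Q) Q = qpoch (N + k) (- Q) Q * (1 - Q ^+ (N + k).+1).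
  by rewrite qpochNS -exprS.
have e2 : qpoch (N + k).+2 (- Q) Q = qpoch (N + k).+1 (- Q) Q * (1 - Q * Q ^+ (N + k).+1).
  exact: qpochNS.
have e3 : qpoch m.+1 (- Q) Q = qpoch m (- Q) Q * (1 - Q * Q ^+ m).
  exact: qpochNS.
move: h0 h1 h2 e1 e2 e3 {step2 hp hb}.
move: (qpoch (2 * N) _ _) (qpoch (N + k).+2 _ _) (qpoch (N + k).+1 _ _) (qpoch (N + k) _ _).
move: (qpoch m.+1 _ _) (qpoch m _ _) (gbin Q N k) (gbin Q N k.+1) (gbin Q N k.+2).
move: (Q ^+ m) (Q ^+ (N + k).+1) => a b d1 d0 g0 g1 g2 P p2 p1 p0 h0 h1 h2 e1 e2 e3.
(* With a = Q^m and b = Q^(N+k+1), each term is completed to the common denominators [d1] and [p2].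
   The induction hypotheses turn all three into multiples of [P]. *)
transitivity ((1 + Q * (a * b)) * (g1 * d0 * p1) * (1 - Q * a) * (1 - Q * b)
  + Q * a * (g0 * d1 * p0) * (1 - b) * (1 - Q * b) + Q * b * (g2 * d0 * p2) * (1 - Q * a)).
  by rewrite e3 e2 e1; ring.
by rewrite h0 h1 h2; ring.
Qed.

Lemma gbin_diag Q N : gbin Q N N = 1.
Proof. by case: N => //= N; rewrite ltnn eqxx. Qed.

Lemma gbinSS Q N k : (k <= N)%N ->
  gbin Q N.+1 k.+1 = (1 + Q ^+ (2 * N).+1) * gbin Q N k.+1
    + Q ^+ (N - k) * gbin Q N k + Q ^+ (N + k).+2 * gbin Q N k.+2.
Proof.
rewrite leq_eqVlt => /orP[/eqP ->|kN]; last by rewrite /= kN addnS.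
by rewrite !gbin_diag subnn mul1r !gbin_gt ?leqnSn // !mulr0 addr0 add0r.
Qed.

Lemma tterm_mull k x y : x * (x * y) ^+ k * tterm k x y = tterm k.+1 x y.
Proof.
rewrite /tterm triS exprMn exprD exprS.
by case: k => [|k]; rewrite ?triS /= ?exprD; ring.
Qed.

(** One half of the bilateral sum. The neighbours of k in the recursion of [gbin] shift the sum by
    one index, which the ratio of consecutive theta terms turns into a factor x or y; the terms with
    [gbin] at 0 and 1 are the boundary of these shifts. *)
Lemma tterm_sum N x y : let S M := \sum_(k < M) tterm k.+1 x y * gbin (x * y) M k.+1 in
  S N.+1 = (1 + (x * y) ^+ (2 * N).+1) * S N
    + (x * y) ^+ N * x * (gbin (x * y) N 0 + S N) + (x * y) ^+ N * y * S N
    - (x * y) ^+ N.+1 * gbin (x * y) N 1.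
Proof.
move=> S; set Q := x * y.
have S1 : \sum_(k < N.+1) tterm k.+1 x y * gbin Q N k.+1 = S N.
  by rewrite big_ord_recr /= gbin_gt // mulr0 addr0.
have S0 : \sum_(k < N.+1) tterm k x y * gbin Q N k = gbin Q N 0 + S N.
  by rewrite big_ord_recl tterm0 mul1r.
have S2 : \sum_(k < N.+1) tterm k.+2 x y * gbin Q N k.+2 = S N - x * gbin Q N 1.
  rewrite -S1 [\sum_(k < _) _ in RHS]big_ord_recl big_ord_recr /= [gbin _ _ _.+2]gbin_gt //.
  by rewrite mulr0 addr0 tterm1 addrC addKr.
rewrite [S N.+1]/S (eq_bigr (fun k : 'I_N.+1 => (1 + Q ^+ (2 * N).+1) *
  (tterm k.+1 x y * gbin Q N k.+1)
  + Q ^+ N * x * (tterm k x y * gbin Q N k) + Q ^+ N * y * (tterm k.+2 x y * gbin Q N k.+2))).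
  rewrite !big_split /= -!mulr_sumr S1 S0 S2 -/Q [Q ^+ N.+1]exprS.
  move: (gbin Q N 0) (gbin Q N 1) (S N) (Q ^+ N) (Q ^+ _) => ? ? ? ? ?.
  by rewrite /Q; ring.
move=> k _; have kN : (k <= N)%N by rewrite -ltnS.
rewrite gbinSS // -(tterm_mull k.+1) -/Q.
have -> : Q ^+ N * y * (x * Q ^+ k.+1 * tterm k.+1 x y * gbin Q N k.+2) =
    Q ^+ (N + k).+2 * tterm k.+1 x y * gbin Q N k.+2.
  transitivity (Q ^+ N * Q * Q ^+ k.+1 * tterm k.+1 x y * gbin Q N k.+2).
    by move: (gbin _ _ _) (tterm _ _ _) (Q ^+ N) (Q ^+ k.+1) => ? ? ? ?; rewrite /Q; ring.
  by rewrite -exprSr -exprD addSn addnS.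
rewrite -[in Q ^+ N * x](subnK kN) exprD -(tterm_mull k) -/Q; ring.
Qed.

(** With Q = x y, passing from N to N+1 multiplies the left side by (1 + x Q^N)(1 + y Q^N) = 1 +
    Q^(2N+1) + Q^N (x + y). The boundary terms of the two halves combine into the recursion of the
    central coefficient. *)
Lemma finite_jacobi N x y :
  qpoch N x (x * y) * qpoch N y (x * y) = gbin (x * y) N 0 +
    \sum_(k < N) (tterm k.+1 x y + tterm k.+1 y x) * gbin (x * y) N k.+1.
Proof.
under eq_bigr do rewrite mulrDl.
rewrite big_split /=.
elim: N => [|N IH]; first by rewrite /qpoch !big_ord0 !addr0 mulr1.
have := tterm_sum N y x; rewrite [y * x]mulrC /= => ->.
have /= -> := tterm_sum N x y.
rewrite !qpochS mulrACA IH /=.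
move: (\sum_(i < N) _) (\sum_(i < N) _) (gbin _ _ _) (gbin _ _ _) => S S' b0 b1.
rewrite [(x * y) ^+ N.+1]exprS [(x * y) ^+ (2 * N).+1]exprS mulnC exprM; ring.
Qed.

Lemma jacobi x y : (x * y)$0 = 0 ->
  theta x y = qinf x (x * y) * qinf y (x * y) * qinf (- (x * y)) (x * y).
Proof.
set Q := x * y => Q0; set E := qinf (- Q) Q.
have E0 : E$0 = 1 by rewrite qinf_coeff0 // coeffN Q0 oppr0.
have EN : cvg (fun N => qpoch N (- Q) Q) E by exact: cvg_qinf.
(* The Gaussian binomials tend to 1/E uniformly in k <= M; theta terms of larger index vanish modulo
   q^M anyway. *)
have Eb M : exists N0, forall N k, (N0 <= N)%N -> (k <= M)%N -> eqm M (gbin Q N k * E) 1.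
  have [N0 hN0] := EN M; exists (N0 + M)%N => N k hN kM.
  have b := @gbin_qpoch Q N k ltac:(lia).
  apply: (eqm_cancel E0); rewrite mulr1.
  apply: (eqm_trans (b := gbin Q N k * qpoch (N - k) (- Q) Q * qpoch (N + k) (- Q) Q)).
    rewrite mulrC; apply: eqmM; last by apply/eqm_sym/hN0; lia.
    by apply: eqmM => //; apply/eqm_sym/hN0; lia.
  by rewrite b; apply: hN0; lia.
apply: (cvg_unique (cvg_theta Q0)) => M.
have cv := cvgM (cvgM (cvg_qinf x Q0) (cvg_qinf y Q0)) (cvg_cst E).
have [N1 h1] := cv M; have [N2 h2] := Eb M.
exists (N1 + N2)%N => N hN.
apply: (eqm_trans (b := qpoch N x Q * qpoch N y Q * E)); last by apply: h1; lia.
rewrite finite_jacobi mulrDl /tsum; apply: eqmD.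
  by apply/eqm_sym/h2; lia.
rewrite mulr_suml; apply: eqm_sum => k _.
have [kM|Mk] := ltnP k M.
  rewrite -[X in eqm _ X _]mulr1 -mulrA; apply: eqmM => //.
  by apply/eqm_sym/h2; lia.
have e0 : eqm M (tterm k.+1 x y + tterm k.+1 y x) 0.
  by rewrite -[0]addr0; apply: eqmD; apply: tterm_eqm0; rewrite ?ltnS // mulrC.
by apply: (eqm_trans e0); apply/eqm_sym; rewrite -mulrA; apply: eqm0Ml.
Qed.

(** The bilateral index is split into the classes 3j, 3j+1 and 3j-1, in the order of the
    summands. *)
Lemma theta_trisect x y : (x * y)$0 = 0 ->
  theta x y = theta (x ^+ 6 * y ^+ 3) (x ^+ 3 * y ^+ 6)
    + x * theta (x ^+ 9 * y ^+ 6) (y ^+ 3) + y * theta (x ^+ 3) (x ^+ 6 * y ^+ 9).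
Proof.
move=> xy0.
have h1 : (x ^+ 6 * y ^+ 3 * (x ^+ 3 * y ^+ 6))$0 = 0.
  rewrite (_ : _ * _ = (x * y) ^+ 9); last by ring.
  by rewrite coeff0X xy0 expr0n.
have h2 : (x ^+ 9 * y ^+ 6 * y ^+ 3)$0 = 0.
  rewrite (_ : _ * _ = (x * y) ^+ 9); last by ring.
  by rewrite coeff0X xy0 expr0n.
have h3 : (x ^+ 3 * (x ^+ 6 * y ^+ 9))$0 = 0.
  rewrite (_ : _ * _ = (x * y) ^+ 9); last by ring.
  by rewrite coeff0X xy0 expr0n.
(* The indices of absolute value at most 3N+1 are exactly the 3j, 3j+1 and 3j-1 with j of absolute
   value at most N, so the partial sums match exactly. *)
apply: (@cvg_unique _ (fun N => tsum (3 * N).+1 x y)).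
  by apply: (cvg_subseq (h := fun N => (3 * N).+1)) _ (cvg_theta xy0) => N; lia.
apply: cvg_ext (cvgD (cvgD (cvg_theta h1) (cvgM (cvg_cst x) (cvg_theta h2)))
  (cvgM (cvg_cst y) (cvg_theta h3))) => N.
elim: N => [|N IH].
  rewrite /tsum !big_ord0 big_ord1 !tterm1; ring.
have tN j : (triangular j * 2 = j * j.+1)%N by exact: triE.
rewrite (_ : (3 * N.+1).+1 = (3 * N).+4)%N; last by lia.
rewrite /tsum in IH *.
rewrite [RHS](_ : _ = 1 + \sum_(k < (3 * N).+1) (tterm k.+1 x y + tterm k.+1 y x)
  + (tterm (3 * N).+2 x y + tterm (3 * N).+2 y x)
  + (tterm (3 * N).+3 x y + tterm (3 * N).+3 y x)
  + (tterm (3 * N).+4 x y + tterm (3 * N).+4 y x)); last first.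
  by rewrite 3!big_ord_recr /= !addrA.
rewrite -IH !big_ord_recr /=.
set S1 := \sum_(i < N) _; set S2 := \sum_(i < N) _; set S3 := \sum_(i < N) _.
have t0 := tN N; have t1 := tN N.+1.
have E1 a b : tterm (3 * N).+2 a b = b * tterm N.+1 (a ^+ 3) (a ^+ 6 * b ^+ 9).
  transitivity (a ^+ (3 * triangular N.+1 + 6 * triangular N) * b ^+ (9 * triangular N).+1).
    by congr (_ ^+ _ * _ ^+ _) => /=; [have := tN (3 * N).+2 | have := tN (3 * N).+1]; lia.
  by rewrite /tterm -[N.+1.-1]/N (exprMn _ (a ^+ 6) (b ^+ 9)) -!exprM exprD exprS; ring.
have E2 a b : tterm (3 * N).+3 a b = tterm N.+1 (a ^+ 6 * b ^+ 3) (a ^+ 3 * b ^+ 6).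
  transitivity (a ^+ (6 * triangular N.+1 + 3 * triangular N)
    * b ^+ (3 * triangular N.+1 + 6 * triangular N)).
    by congr (_ ^+ _ * _ ^+ _) => /=; [have := tN (3 * N).+3 | have := tN (3 * N).+2]; lia.
  by rewrite /tterm -[N.+1.-1]/N (exprMn _ (a ^+ 6) (b ^+ 3))
    (exprMn _ (a ^+ 3) (b ^+ 6)) -!exprM !exprD; ring.
have E3 a b : tterm (3 * N).+4 a b = a * tterm N.+1 (a ^+ 9 * b ^+ 6) (b ^+ 3).
  transitivity (a ^+ (9 * triangular N.+1).+1 * b ^+ (6 * triangular N.+1 + 3 * triangular N)).
    by congr (_ ^+ _ * _ ^+ _) => /=; [have := tN (3 * N).+4 | have := tN (3 * N).+3]; lia.
  by rewrite /tterm -[N.+1.-1]/N (exprMn _ (a ^+ 9) (b ^+ 6)) -!exprM exprD exprS; ring.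
rewrite !E1 !E2 !E3.
rewrite ![y ^+ _ * x ^+ _]mulrC; ring.
Qed.

End Products.

(** * Trisection of power series *)

Section Trisection.
Variable R : comNzRingType.
Implicit Types a b c x y Q : fps R.
Local Notation q := (fpsX R).

Definition inflate a : fps R := Fps (fun n => if (3 %| n)%N then a$(n %/ 3)%N else 0).
Definition trisection (i : nat) a : fps R := Fps (fun n => a$(3 * n + i)).
Local Notation V := inflate.
Local Notation U := trisection.

Lemma coeff_inflate a n : (V a)$(3 * n) = a$n.
Proof. by rewrite /= dvdn_mulr // mulKn. Qed.

Lemma trisectionD i a b : U i (a + b) = U i a + U i b.
Proof. exact: fpsP. Qed.

(** Extraction of a residue class is linear over series in q^3, as only indices divisible by 3
    contribute to the convolution. *)
Lemma trisection_inflateM i a b : (i < 3)%N -> U i (V a * b) = a * U i b.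
Proof.
move=> i3; apply: fpsP => n; rewrite [LHS]coeffM coeffM.
transitivity (\sum_(k < (3 * n).+1) (V a)$k * b$(3 * n + i - k)).
  rewrite -(big_mkord xpredT (fun k => (V a)$k * b$(3 * n + i - k))).
  rewrite (big_cat_nat _ (n := (3 * n).+1)) //=; last by lia.
  rewrite big_mkord [X in _ + X]big_nat [X in _ + X]big1 ?addr0 // => k hk.
  by rewrite ifF ?mul0r //; lia.
have b3 k : (k <= n)%N -> (U i b)$(n - k) = b$(3 * n + i - 3 * k).
  by move=> kn /=; congr (b$_); lia.
rewrite [RHS](eq_bigr (fun k : 'I_n.+1 => (V a)$(3 * k) * b$(3 * n + i - 3 * k))); last first.
  by move=> k _; rewrite coeff_inflate b3 // -ltnS.
move: (3 * n + i)%N => m {b3 i3}.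
elim: n => [|n IH]; first by rewrite !big_ord1.
rewrite (_ : (3 * n.+1).+1 = (3 * n).+4)%N; last by lia.
rewrite 3!big_ord_recr [RHS]big_ord_recr /= IH -!addrA; congr (_ + _).
rewrite ifF; last by lia.
rewrite ifF; last by lia.
rewrite !mul0r !add0r; congr (_ * b$(m - _)); last by lia.
by rewrite dvdn_mulr // ifT; [congr (a$_) | ]; lia.
Qed.

Lemma trisection1 i : U i 1 = (i == 0)%:R.
Proof.
apply: fpsP => n; rewrite /= addn_eq0 muln_eq0 /=.
by case: i => [|i]; rewrite ?andbT ?andbF.
Qed.

Lemma inflateK a : U 0 (V a) = a.
Proof. by rewrite -[V a]mulr1 trisection_inflateM // trisection1 mulr1. Qed.

Lemma fps_trisect a : a = V (U 0 a) + q * V (U 1 a) + q ^+ 2 * V (U 2 a).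
Proof.
apply: fpsP => n; rewrite !coeffD coeffXM coeffXnM.
case: n => [|[|n]]; rewrite /= ?addr0 ?add0r // subn2 /=.
have [h2|h2] := boolP (3 %| n.+2)%N; have [h1|h1] := boolP (3 %| n.+1)%N;
  have [h0|h0] := boolP (3 %| n)%N; try lia; rewrite ?addr0 ?add0r; congr (a$_); lia.
Qed.

Fact inflate_is_additive : additive V.
Proof. by move=> a b; apply: fpsP => n /=; case: ifP => // _; rewrite subr0. Qed.
HB.instance Definition _ := GRing.isAdditive.Build (fps R) (fps R) V inflate_is_additive.

Lemma trisection_inflate i a : (0 < i < 3)%N -> U i (V a) = 0.
Proof.
by case/andP=> i0 i3; rewrite -[V a]mulr1 trisection_inflateM // trisection1 gtn_eqF ?mulr0.
Qed.

Fact inflate_is_monoid_morphism : monoid_morphism V.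
Proof.
split.
  apply: fpsP => -[|n] //=; case: ifP => // h.
  by rewrite (_ : _ == _ = false) //; lia.
move=> a b; rewrite [RHS]fps_trisect !trisection_inflateM // inflateK.
by rewrite !trisection_inflate // !mulr0 raddf0 !mulr0 !addr0.
Qed.
HB.instance Definition _ :=
  GRing.isMonoidMorphism.Build (fps R) (fps R) V inflate_is_monoid_morphism.

Lemma inflateX : V q = q ^+ 3.
Proof.
apply: fpsP => n.
rewrite coeffXn /=; case: ifP => h; first by congr ((nat_of_bool _)%:R); lia.
by rewrite (_ : _ == _ = false) //; lia.
Qed.

Lemma inflate_coeff0 a : (V a)$0 = a$0.
Proof. by []. Qed.

Lemma trisectionXn i k : (i < 3)%N -> (k < 3)%N -> U i (q ^+ k) = (i == k)%:R.
Proof.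
move=> i3 k3; apply: fpsP => n; rewrite [LHS]coeffXn.
have [->|ik] := eqVneq i k; last by rewrite (_ : _ == _ = false) //; lia.
by rewrite coeff1; congr ((nat_of_bool _)%:R); lia.
Qed.

Lemma trisection_trisect a b c i : (i < 3)%N ->
  U i (V a + q * V b + q ^+ 2 * V c) = nth 0 [:: a; b; c] i.
Proof.
move=> i3; have X k d : (k < 3)%N -> U i (q ^+ k * V d) = d * (i == k)%:R.
  by move=> k3; rewrite mulrC trisection_inflateM // trisectionXn.
rewrite !trisectionD -[V a]mul1r -[1 * V a]/(q ^+ 0 * V a) -[q * V b]/(q ^+ 1 * V b) !X //.
by case: i i3 {X} => [|[|[|i]]] //= _; rewrite !mulr0 ?mulr1 ?addr0 ?add0r.
Qed.

(* [inflate (norm a)] is the product of [a(q)], [a(w q)], [a(w^2 q)] for a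
   primitive cube root of unity [w]. *)
Definition norm a : fps R := U 0 a ^+ 3 + q * U 1 a ^+ 3 + q ^+ 2 * U 2 a ^+ 3
  - (q * U 0 a * U 1 a * U 2 a) *+ 3.

Lemma norm_trisect a b c : norm (V a + q * V b + q ^+ 2 * V c) =
  a ^+ 3 + q * b ^+ 3 + q ^+ 2 * c ^+ 3 - (q * a * b * c) *+ 3.
Proof. by rewrite /norm !trisection_trisect. Qed.

(** The norm is the determinant of multiplication by a in the basis 1, q, q^2 over series in q^3.
    The proof multiplies the two trisections, q^3 being [V q]. *)
Lemma normM a b : norm (a * b) = norm a * norm b.
Proof.
rewrite (fps_trisect a) (fps_trisect b).
move: (U 0 a) (U 1 a) (U 2 a) (U 0 b) (U 1 b) (U 2 b) => a0 a1 a2 b0 b1 b2.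
have -> : (V a0 + q * V a1 + q ^+ 2 * V a2) * (V b0 + q * V b1 + q ^+ 2 * V b2) =
    V (a0 * b0 + q * (a1 * b2 + a2 * b1)) + q * V (a0 * b1 + a1 * b0 + q * (a2 * b2))
    + q ^+ 2 * V (a0 * b2 + a1 * b1 + a2 * b0).
  by rewrite !rmorphD !rmorphM !rmorphD !rmorphM /= inflateX; ring.
by rewrite !norm_trisect; ring.
Qed.

Lemma norm_inflate a : norm (V a) = a ^+ 3.
Proof.
have := norm_trisect a 0 0; rewrite raddf0 !mulr0 !addr0 => ->.
by rewrite !expr0n !mulr0 mul0rn subr0 !addr0.
Qed.

Lemma norm1 : norm 1 = 1.
Proof. by rewrite -{1}(rmorph1 V) norm_inflate expr1n. Qed.

Lemma cvg_section i u a : cvg u a -> cvg (fun N => U i (u N)) (U i a).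
Proof.
move=> ua M; have [N0 h] := ua (3 * M + i)%N; exists N0 => N /h uN n nM /=.
by apply: uN; lia.
Qed.

Lemma cvg_inflate u a : cvg u a -> cvg (fun N => V (u N)) (V a).
Proof.
move=> ua M; have [N0 h] := ua M; exists N0 => N /h uN n nM /=.
by case: ifP => // _; apply: uN; apply: leq_ltn_trans nM; apply: leq_div.
Qed.

Lemma cvgX u a k : cvg u a -> cvg (fun N => u N ^+ k) (a ^+ k).
Proof.
move=> ua; elim: k => [|k IH]; first exact: cvg_cst.
by rewrite exprS; apply: cvg_ext (cvgM ua IH) => N; rewrite exprS.
Qed.

Lemma cvg_norm u a : cvg u a -> cvg (fun N => norm (u N)) (norm a).
Proof.
move=> ua; have h i := @cvg_section i _ _ ua.
rewrite /norm -[_ *+ 3]mulr_natr -mulrN.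
have h3 := cvgM (cvgM (cvgM (cvgM (cvg_cst q) (h 0)) (h 1)) (h 2)) (cvg_cst (- 3%:R)).
apply: (cvg_ext _ (cvgD (cvgD (cvgD (cvgX 3 (h 0)) (cvgM (cvg_cst q) (cvgX 3 (h 1))))
  (cvgM (cvg_cst (q ^+ 2)) (cvgX 3 (h 2)))) h3)) => N.
by rewrite mulrN mulr_natr.
Qed.

Lemma qpoch_inflate N a Q : V (qpoch N a Q) = qpoch N (V a) (V Q).
Proof.
rewrite /qpoch rmorph_prod; apply: eq_bigr => i _.
by rewrite rmorphD rmorph1 rmorphM rmorphXn.
Qed.

Lemma qinf_inflate a Q : Q$0 = 0 -> V (qinf a Q) = qinf (V a) (V Q).
Proof.
move=> Q0; apply: (@cvg_unique _ (fun N => qpoch N (V a) (V Q))); last exact: cvg_qinf.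
by apply: cvg_ext (cvg_inflate (cvg_qinf a Q0)) => N; rewrite qpoch_inflate.
Qed.

Lemma theta_inflate x y : (x * y)$0 = 0 -> V (theta x y) = theta (V x) (V y).
Proof.
move=> xy0; apply: (@cvg_unique _ (fun N => tsum N (V x) (V y))); last first.
  by apply: cvg_theta; rewrite -rmorphM.
apply: cvg_ext (cvg_inflate (cvg_theta xy0)) => N.
rewrite /tsum rmorphD rmorph1 rmorph_sum; congr (1 + _); apply: eq_bigr => i _.
by rewrite rmorphD /tterm !rmorphM !rmorphXn.
Qed.

(** Each factor 1 + q d(q^3) has norm 1 + q d^3, and norms pass to the limit. The next lemma does
    the same with q^2. *)
Lemma norm_qinf1 c Q : Q$0 = 0 ->
  norm (qinf (q * V c) (V Q)) = qinf (q * c ^+ 3) (Q ^+ 3).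
Proof.
move=> Q0; have Q30 : (Q ^+ 3)$0 = 0 by rewrite coeff0X Q0 expr0n.
apply: (cvg_unique _ (cvg_qinf _ Q30)).
apply: cvg_ext (cvg_norm (cvg_qinf (q * V c) (Q0 : (V Q)$0 = 0))) => N.
elim: N => [|N IH]; first by rewrite /qpoch !big_ord0 norm1.
rewrite !qpochS normM IH; congr (_ * _).
rewrite -rmorphXn -mulrA -rmorphM.
have := norm_trisect 1 (c * Q ^+ N) 0; rewrite rmorph1 raddf0 mulr0 addr0 => ->.
by rewrite expr1n !mulr0 expr0n mulr0 mul0rn subr0 addr0 exprMn exprAC mulrA.
Qed.

Lemma norm_qinf2 c Q : Q$0 = 0 ->
  norm (qinf (q ^+ 2 * V c) (V Q)) = qinf (q ^+ 2 * c ^+ 3) (Q ^+ 3).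
Proof.
move=> Q0; have Q30 : (Q ^+ 3)$0 = 0 by rewrite coeff0X Q0 expr0n.
apply: (cvg_unique _ (cvg_qinf _ Q30)).
apply: cvg_ext (cvg_norm (cvg_qinf (q ^+ 2 * V c) (Q0 : (V Q)$0 = 0))) => N.
elim: N => [|N IH]; first by rewrite /qpoch !big_ord0 norm1.
rewrite !qpochS normM IH; congr (_ * _).
rewrite -rmorphXn -mulrA -rmorphM.
have := norm_trisect 1 0 (c * Q ^+ N); rewrite rmorph1 raddf0 mulr0 addr0 => ->.
by rewrite expr1n expr0n !mulr0 mul0r mul0rn subr0 addr0 exprMn exprAC mulrA.
Qed.

End Trisection.

(** * The trisection of f1 f2 *)

(* [euler R k] is f_k, [phi] is phi(-q) and [psi_twice] is 2 psi(q), as the exponents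
   k(k+1)/2 of [theta 1 q] occur for both [k] and [-k-1]. *)
HB.lock Definition euler (R : comNzRingType) (k : nat) : fps R :=
  qinf (- fpsX R ^+ k) (fpsX R ^+ k).
HB.lock Definition phi (R : comNzRingType) : fps R := theta (- fpsX R) (- fpsX R).
HB.lock Definition psi_twice (R : comNzRingType) : fps R := theta 1 (fpsX R).
HB.lock Definition theta12 (R : comNzRingType) : fps R := theta (fpsX R) (fpsX R ^+ 2).
HB.lock Definition theta15 (R : comNzRingType) : fps R := theta (- fpsX R) (- fpsX R ^+ 5).
HB.lock Definition euler12 (R : comNzRingType) : fps R := euler R 1 * euler R 2.
(** This and the next series are A and B in f1 f2 = A(q^3) - q f9 f18 - q^2 B(q^3). *)
HB.lock Definition euler12_comp0 (R : comNzRingType) : fps R := theta12 R * inflate (phi R).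
HB.lock Definition euler12_comp2 (R : comNzRingType) : fps R := inflate (psi_twice R) * theta15 R.

Section ThetaProducts.
Variable R : comNzRingType.
Local Notation q := (fpsX R).
Local Notation V := (@inflate R).
Local Notation U := (@trisection R).

Local Notation f := (euler R).
Local Notation phi := (phi R).
Local Notation psi_twice := (psi_twice R).
Local Notation theta12 := (theta12 R).
Local Notation theta15 := (theta15 R).
Local Notation W := (euler12 R).
Local Notation euler12_comp0 := (euler12_comp0 R).
Local Notation euler12_comp2 := (euler12_comp2 R).

Lemma eulerE k : f k = qinf (- q ^+ k) (q ^+ k).
Proof. by rewrite euler.unlock. Qed.

Lemma coeff0_fpsXn k : (0 < k)%N -> (q ^+ k)$0 = 0.
Proof. by case: k => // k _; rewrite coeffXn. Qed.

Lemma euler_coeff0 k : (0 < k)%N -> (f k)$0 = 1.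
Proof. by move=> k0; rewrite eulerE qinf_coeff0 // coeffN coeff0_fpsXn // oppr0. Qed.

Lemma euler_lreg k : (0 < k)%N -> GRing.lreg (f k).
Proof. by move=> k0; apply: fps_lreg; apply: euler_coeff0. Qed.

Lemma inflate_euler k : (0 < k)%N -> V (f k) = f (3 * k).
Proof.
move=> k0; rewrite !eulerE (qinf_inflate _ (coeff0_fpsXn k0)) rmorphN !rmorphXn /=.
by rewrite inflateX -exprM.
Qed.

Lemma euler1_odd : qinf (- q) (q ^+ 2) * f 2 = f 1.
Proof.
rewrite !eulerE !expr1 [RHS](@qinf_split2 _ _ q erefl).
by congr (_ * qinf _ _); rewrite mulNr expr2.
Qed.

Lemma qinf_euler k : (0 < k)%N -> qinf (q ^+ k) (q ^+ k) * f k = f (2 * k).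
Proof.
by move=> k0; rewrite !eulerE (qinf_sqr _ (coeff0_fpsXn k0)) -exprM mulnC.
Qed.

Lemma phi_euler : phi * f 2 = f 1 ^+ 2.
Proof.
have e : - q * - q = q ^+ 2 by rewrite mulrNN expr2.
have e0 : (- q * - q)$0 = 0 by rewrite e coeffXn.
rewrite phi.unlock (jacobi e0) e -eulerE -euler1_odd.
by move: (qinf _ _) (f 2) => ? ?; ring.
Qed.

Lemma psi_twice_euler : psi_twice * f 1 = f 2 ^+ 2 *+ 2.
Proof.
have e0 : (1 * q)$0 = 0 by rewrite mul1r.
(* The factor 1 + 1 peeled off the product is the origin of the 2. *)
rewrite psi_twice.unlock (jacobi e0) (qinf_peel _ e0) !mul1r.
have -> : qinf (- q) q = f 1 by rewrite eulerE expr1.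
have := @qinf_euler 1 isT; rewrite expr1 muln1 => <-.
by move: (qinf _ _) (f 1) => ? ?; ring.
Qed.

Lemma theta12_euler : theta12 * f 6 * f 1 = f 2 * f 3 ^+ 2.
Proof.
have e : q * q ^+ 2 = q ^+ 3 by rewrite -exprS.
have e0 : (q * q ^+ 2)$0 = 0 by rewrite e coeffXn.
rewrite theta12.unlock (jacobi e0) e -eulerE.
have := @qinf_euler 1 isT; rewrite expr1 muln1 => <-.
rewrite -(@qinf_euler 3 isT) (@qinf_split3 _ _ q erefl) -expr2 -exprS.
by move: (f 1) (f 3) (qinf _ _) (qinf _ _) (qinf _ _) => ? ? ? ? ?; ring.
Qed.

Lemma theta15_euler : theta15 * f 3 * f 2 = f 1 * f 6 ^+ 2.
Proof.
have e : - q * - q ^+ 5 = q ^+ 6 by rewrite mulrNN -exprS.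
have e0 : (- q * - q ^+ 5)$0 = 0 by rewrite e coeffXn.
have e2 : (q ^+ 2)$0 = 0 by rewrite coeffXn.
have e3 : (q ^+ 3)$0 = 0 by rewrite coeffXn.
rewrite theta15.unlock (jacobi e0) e -eulerE -euler1_odd (qinf_split3 _ e2) -!exprM.
have -> : f 3 = qinf (- q ^+ 3) (q ^+ 6) * f 6.
  by rewrite !eulerE (qinf_split2 _ e3) -exprM mulNr -exprD.
rewrite !mulNr -!exprS.
by move: (f 2) (f 6) (qinf _ _) (qinf _ _) (qinf _ _) => ? ? ? ? ?; ring.
Qed.

Lemma euler12_coeff0 : W$0 = 1.
Proof. by rewrite euler12.unlock coeff0M !euler_coeff0 // mulr1. Qed.

Lemma inflate_euler12 : V W = f 3 * f 6.
Proof. by rewrite euler12.unlock rmorphM /= !inflate_euler. Qed.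

Lemma psi_twice_phi : psi_twice * phi = W *+ 2.
Proof.
apply: (@euler_lreg 1 isT); apply: (@euler_lreg 2 isT).
have := phi_euler; have := psi_twice_euler; rewrite euler12.unlock.
move: psi_twice phi (f 1) (f 2) => p h f1 f2 hp hh.
transitivity ((p * f1) * (h * f2)); first by ring.
by rewrite hp hh; ring.
Qed.

Lemma theta12_theta15 : theta12 * theta15 = V W.
Proof.
apply: (@euler_lreg 1 isT); apply: (@euler_lreg 2 isT).
apply: (@euler_lreg 3 isT); apply: (@euler_lreg 6 isT).
rewrite inflate_euler12; have := theta12_euler; have := theta15_euler.
move: theta12 theta15 (f 1) (f 2) (f 3) (f 6) => a b f1 f2 f3 f6 h15 h12.
transitivity ((a * f6 * f1) * (b * f3 * f2)); first by ring.
by rewrite h12 h15; ring.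
Qed.

Lemma euler12_comp02 : euler12_comp0 * euler12_comp2 = V W ^+ 2 *+ 2.
Proof.
transitivity ((theta12 * theta15) * (V (psi_twice * phi))).
  rewrite rmorphM euler12_comp0.unlock euler12_comp2.unlock /=.
  by move: theta12 theta15 (V phi) (V psi_twice) => ? ? ? ?; ring.
rewrite theta12_theta15 psi_twice_phi rmorphMn /=.
by move: (V W) => ?; ring.
Qed.

(** For x = y = -q the classes 3j+1 and 3j-1 give equal sums by symmetry. *)
Lemma phi_trisect : phi = V (V phi) - (q * V theta15) *+ 2.
Proof.
have h : (- q * - q)$0 = 0 by rewrite mulrNN -expr2 coeffXn.
have h3 : (V (- q) * V (- q))$0 = 0 by rewrite -rmorphM inflate_coeff0.
have h5 : (- q * - q ^+ 5)$0 = 0 by rewrite mulrNN -exprS coeffXn.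
have v9 : V (V (- q)) = - q ^+ 9.
  by rewrite rmorphN rmorphN /= inflateX rmorphXn /= inflateX -exprM.
have v15 : V (- q ^+ 5) = - q ^+ 15.
  by rewrite rmorphN rmorphXn /= inflateX -exprM.
have v3 : V (- q) = - q ^+ 3 by rewrite rmorphN /= inflateX.
rewrite {1}phi.unlock (theta_trisect h) phi.unlock theta15.unlock
  (theta_inflate h) (theta_inflate h3).
rewrite (theta_inflate h5) v9 v15 v3.
have e k l m : (k + l = m.*2.+1)%N -> (- q) ^+ k * (- q) ^+ l = - q ^+ m.*2.+1.
  by move=> klm; rewrite -exprD klm exprNn -signr_odd /= odd_double mulN1r.
rewrite (e 6 3 4)%N // (e 3 6 4)%N // (e 9 6 7)%N // (e 6 9 7)%N //.
have -> : (- q) ^+ 3 = - q ^+ 3 by have := e 3%N 0%N 1%N erefl; rewrite expr0 mulr1.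
rewrite [theta _ (- q ^+ 3)]theta_sym.
by move: (theta _ _) (theta _ _) => ? ?; ring.
Qed.

(** For x = 1 and y = q the classes 3j and 3j+1 give equal sums, and 3j-1 reproduces the series at
    q^9. *)
Lemma psi_twice_trisect : psi_twice = V theta12 *+ 2 + q * V (V psi_twice).
Proof.
have h : (1 * q)$0 = 0 by rewrite mul1r.
have h3 : (V 1 * V q)$0 = 0 by rewrite -rmorphM inflate_coeff0.
have h2 : (q * q ^+ 2)$0 = 0 by rewrite -exprS coeffXn.
have v9 : V (V q) = q ^+ 9 by rewrite inflateX rmorphXn /= inflateX -exprM.
have v6 : V (q ^+ 2) = q ^+ 6 by rewrite rmorphXn /= inflateX -exprM.
rewrite {1}psi_twice.unlock (theta_trisect h) psi_twice.unlock theta12.unlock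
  (theta_inflate h) (theta_inflate h3).
rewrite (theta_inflate h2) v9 v6 !rmorph1 inflateX !expr1n !mul1r.
by rewrite [theta (q ^+ 6) _]theta_sym mulr2n.
Qed.

(** The factors 1 - q^m with m prime to 3 are their own norms and multiply to f1/f3. The others form
    [V (f 1)], of norm f1^3. *)
Lemma norm_euler1 : norm (f 1) * f 3 = f 1 ^+ 4.
Proof.
have e3 : f 1 = qinf (- q) (q ^+ 3) * qinf (- q ^+ 2) (q ^+ 3) * V (f 1).
  rewrite (inflate_euler (k := 1)) // !eulerE expr1 [LHS](@qinf_split3 _ _ q erefl).
  by rewrite !mulNr -!exprS.
have n1 : norm (qinf (- q) (q ^+ 3)) = qinf (- q) (q ^+ 3).
  have := @norm_qinf1 R (-1) q erefl; rewrite inflateX rmorphN1 mulrN1 => ->.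
  by congr qinf; ring.
have n2 : norm (qinf (- q ^+ 2) (q ^+ 3)) = qinf (- q ^+ 2) (q ^+ 3).
  have := @norm_qinf2 R (-1) q erefl; rewrite inflateX rmorphN1 mulrN1 => ->.
  by congr qinf; ring.
rewrite {1}e3 2!normM n1 n2 norm_inflate [RHS]exprS {2}e3 (inflate_euler (k := 1)) //.
by move: (qinf _ _) (qinf _ _) (f 1) (f (3 * 1)) => ? ? ? ?; ring.
Qed.

Lemma norm_euler2 : norm (f 2) * f 6 = f 2 ^+ 4.
Proof.
have q2 : (q ^+ 2)$0 = 0 by rewrite coeffXn.
have v6 : V (q ^+ 2) = q ^+ 6 by rewrite rmorphXn /= inflateX -exprM.
have e3 : f 2 = qinf (- q ^+ 2) (q ^+ 6) * qinf (- q ^+ 4) (q ^+ 6) * V (f 2).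
  rewrite (inflate_euler (k := 2)) // !eulerE [LHS](qinf_split3 _ q2).
  by rewrite !mulNr -!exprM -!exprD.
have n1 : norm (qinf (- q ^+ 4) (q ^+ 6)) = qinf (- q ^+ 4) (q ^+ 6).
  have := @norm_qinf1 R (- q) (q ^+ 2) q2.
  rewrite v6 rmorphN /= inflateX mulrN -exprS -exprM => ->.
  by congr qinf; ring.
have n2 : norm (qinf (- q ^+ 2) (q ^+ 6)) = qinf (- q ^+ 2) (q ^+ 6).
  have := @norm_qinf2 R (-1) (q ^+ 2) q2; rewrite v6 rmorphN1 mulrN1 -exprM => ->.
  by congr qinf; ring.
rewrite {1}e3 2!normM n1 n2 norm_inflate [RHS]exprS {2}e3 (inflate_euler (k := 2)) //.
by move: (qinf _ _) (qinf _ _) (f 2) (f (3 * 2)) => ? ? ? ?; ring.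
Qed.

Lemma norm_euler12 : norm W * V W = W ^+ 4.
Proof.
rewrite inflate_euler12 euler12.unlock normM exprMn -norm_euler1 -norm_euler2.
by move: (norm _) (norm _) (f 3) (f 6) => ? ? ? ?; ring.
Qed.

Hypothesis R_torsion2 : injective (fun a : R => a *+ 2).

(** The trisections of 2 psi(q) and phi(-q) are multiplied. The middle component is (2 - 4) f9 f18,
    and the absence of 2-torsion allows halving. *)
Lemma euler12_trisect : W = V euler12_comp0 - q * V (V W) - q ^+ 2 * V euler12_comp2.
Proof.
have two (a b : fps R) : a *+ 2 = b *+ 2 -> a = b.
  move=> ab; apply: fpsP => n; apply: R_torsion2.
  by have := congr1 (fun c => c$n) ab; rewrite !coeffMn.
apply: two; rewrite -psi_twice_phi {1}psi_twice_trisect {1}phi_trisect.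
transitivity (V euler12_comp0 *+ 2 + q * (V (V (psi_twice * phi)) - V (theta12 * theta15) *+ 4)
   - q ^+ 2 * V euler12_comp2 *+ 2).
  rewrite euler12_comp0.unlock euler12_comp2.unlock !rmorphM /=.
  by move: (V theta12) (V theta15) (V (V phi)) (V (V psi_twice)) => ? ? ? ?; ring.
rewrite psi_twice_phi theta12_theta15 !rmorphMn /=.
by move: (V (V W)) (V euler12_comp0) (V euler12_comp2) => ? ? ?; ring.
Qed.

(* For [y = W / (q V (V W))] this says [y^3 + 3 y^2 + 9 y =
   V W ^+ 4 / (q^3 V (V W) ^+ 4)]. *)
Lemma euler12_modular : V (V W) * W ^+ 3 + q * V (V W) ^+ 2 * W ^+ 2 *+ 3
  + q ^+ 2 * V (V W) ^+ 3 * W *+ 9 = V W ^+ 4.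
Proof.
have hW : W = V euler12_comp0 + q * V (- V W) + q ^+ 2 * V (- euler12_comp2).
  by rewrite {1}euler12_trisect !rmorphN !mulrN.
have := norm_euler12; rewrite {1}hW norm_trisect => /(congr1 V).
rewrite !(rmorphXn, rmorphM, rmorphB, rmorphD, rmorphMn, rmorphN) /= inflateX.
move=> <-; have := euler12_trisect.
have := congr1 V euler12_comp02; rewrite !rmorphM rmorphMn rmorphXn /=.
move: (V euler12_comp0) (V euler12_comp2) (V (V W)) => a b D abD ->.
transitivity (a ^+ 3 * D - q ^+ 3 * D ^+ 4 - q ^+ 6 * b ^+ 3 * D
    - q ^+ 3 * D ^+ 2 * (a * b) *+ 3); last by ring.
(* The two sides differ by a multiple of 2 D^2 - a b, which vanishes because A B = 2 (f3 f6)^2. *)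
transitivity ((a ^+ 3 * D - q ^+ 3 * D ^+ 4 - q ^+ 6 * b ^+ 3 * D
    - q ^+ 3 * D ^+ 2 * (a * b) *+ 3)
   + (D ^+ 2 *+ 2 - a * b) * ((a - q ^+ 2 * b - q * D) * q ^+ 2 * D *+ 3)); first by ring.
by rewrite abD subrr mul0r addr0.
Qed.

End ThetaProducts.

(** * The operator U on powers of s *)

(** One third of the i-th power sum of the roots of S^3 = t (1 + 3 S + 9 S^2), whose roots are the
    conjugates of s once t is taken at q^3. *)
Fixpoint trace_poly (i : nat) : {poly int} :=
  match i with
  | 0 => 1
  | 1 => 'X *+ 3
  | 2 => 'X *+ 2 + 'X^2 *+ 27
  | (((i3.+1) as i2).+1 as i1).+1 =>
      'X * (trace_poly i3 + trace_poly i2 *+ 3 + trace_poly i1 *+ 9)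
  end.

Lemma trace_polyS3 i : trace_poly i.+3 =
  'X * (trace_poly i + trace_poly i.+1 *+ 3 + trace_poly i.+2 *+ 9).
Proof. by []. Qed.

Lemma coef_trace_polyS3 i k : (trace_poly i.+3)`_k.+1 =
  (trace_poly i)`_k + (trace_poly i.+1)`_k *+ 3 + (trace_poly i.+2)`_k *+ 9.
Proof. by rewrite trace_polyS3 coefXM 2!coefD !coefMn. Qed.

(** Since s has order at least 1 in q, U s^i has order at least i/3. In the recursion, three steps
    in i gain a factor ['X]. *)
Lemma trace_poly_low i k : (3 * k < i)%N -> (trace_poly i)`_k = 0.
Proof.
move: i k; elim/ltn_ind => -[|[|[|i]]] IH k //.
- by case: k => [|k] hk; [rewrite coefMn coefX | lia].
- by case: k => [|k] hk; [rewrite coefD !coefMn coefX coefXn | lia].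
- case: k => [|k] hk; first by rewrite trace_polyS3 coefXM.
  by rewrite coef_trace_polyS3 !IH //; lia.
Qed.

(** The coefficient of t^k in U s^i has 3-adic valuation at least 3k - i - 1. In the recursion the
    weights 1, 3, 9 balance the shifts of i by 3, 2, 1 exactly. *)
Lemma trace_poly_dvd i k :
  (((27 ^ k)%N : int) %| (3 ^ i.+1)%N%:Z * (trace_poly i)`_k)%Z.
Proof.
move: i k; elim/ltn_ind => -[|[|[|i]]] IH k.
- by rewrite coef1; case: k => [|k]; rewrite ?mulr0 ?dvdz0.
- rewrite coefMn coefX; case: k => [|[|k]] //; by rewrite mul0rn mulr0 dvdz0.
- rewrite coefD !coefMn coefX coefXn; case: k => [|[|[|k]]] //=.
case: k => [|k]; first by rewrite trace_polyS3 coefXM mulr0 dvdz0.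
rewrite coef_trace_polyS3 (expnS 27) PoszM.
have -> : (3 ^ i.+4)%N%:Z * ((trace_poly i)`_k + (trace_poly i.+1)`_k *+ 3
      + (trace_poly i.+2)`_k *+ 9) = 27%:Z * ((3 ^ i.+1)%N%:Z * (trace_poly i)`_k
   + (3 ^ i.+2)%N%:Z * (trace_poly i.+1)`_k + (3 ^ i.+3)%N%:Z * (trace_poly i.+2)`_k).
  rewrite !expnS !PoszM; ring.
by rewrite dvdz_mul // !rpredD ?IH //; lia.
Qed.

Definition trace_quot (i n : nat) : {poly int} := drop_poly n (trace_poly i).

(** The hypothesis says that n is at most i/3 rounded up. *)
Lemma trace_quotE i n : (3 * n <= i.+2)%N -> trace_poly i = trace_quot i n * 'X^n.
Proof.
move=> ni; rewrite -[LHS](poly_take_drop n) [take_poly _ _](_ : _ = 0) ?add0r //.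
apply/polyP => k; rewrite coef_take_poly coef0; case: ifP => // kn.
by rewrite trace_poly_low //; lia.
Qed.

Lemma coef_trace_quot i n k : (trace_quot i n)`_k = (trace_poly i)`_(k + n).
Proof. by rewrite coef_drop_poly. Qed.

Section ModularU.
Variable R : comNzRingType.
Hypothesis R_torsion2 : injective (fun a : R => a *+ 2).
Local Notation q := (fpsX R).
Local Notation V := (@inflate R).
Local Notation U := (@trisection R).
Local Notation W := (euler12 R).

Lemma trisection0_XM (a : fps R) : U 0 (q * a) = q * U 2 a.
Proof.
apply: fpsP => n; rewrite [LHS]/= !coeffXM; case: n => // n.
by rewrite (_ : (3 * n.+1 + 0 = (3 * n).+3)%N) //=; [congr (a$_)|]; lia.
Qed.

Lemma trisectionS_XM i (a : fps R) : U i.+1 (q * a) = U i a.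
Proof. by apply: fpsP => n; rewrite /= addnS coeffXM. Qed.

(** [G] stands for f3 f6 / (f1 f2), specified by a product relation instead of a quotient. *)
Variable G : fps R.
Hypothesis G_euler12 : G * W = V W.
Local Notation G3 := (V G).
Local Notation s := (q * G * G3).
Local Notation t := (q * G ^+ 4).

Lemma euler12_lreg : GRing.lreg W.
Proof. exact/fps_lreg/euler12_coeff0. Qed.

Lemma inflate_euler12_lreg : GRing.lreg (V W).
Proof. by apply: fps_lreg; rewrite inflate_coeff0 euler12_coeff0. Qed.

Lemma inflate2_euler12_lreg : GRing.lreg (V (V W)).
Proof. by apply: fps_lreg; rewrite !inflate_coeff0 euler12_coeff0. Qed.

Lemma G_lreg : GRing.lreg G.
Proof.
apply: fps_lreg; have /(congr1 (fun a => a$0)) := G_euler12.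
by rewrite coeff0M inflate_coeff0 euler12_coeff0 mulr1.
Qed.

Lemma inflate_ratio : G3 * V W = V (V W).
Proof. by rewrite -[in RHS]G_euler12 rmorphM. Qed.

(** The modular relation of [W] divided by [V W ^+ 4] and multiplied by G^3. It shows that G^3 is a
    series in q^3 modulo 3. *)
Lemma G_cube : G ^+ 3 = G3 + q * G * G3 ^+ 2 *+ 3 + q ^+ 2 * G ^+ 2 * G3 ^+ 3 *+ 9.
Proof.
apply: (@lregX _ _ 4 inflate_euler12_lreg);
  have := euler12_modular R_torsion2; have := inflate_ratio; have := G_euler12.
move: (V G) W (V W) (V (V W)) => g w C D <- <- /esym h.
transitivity (G ^+ 3 * (G * w) ^+ 4); first by ring.
by rewrite {1}h; ring.
Qed.

Lemma s_cube : s ^+ 3 = V t * (1 + s *+ 3 + s ^+ 2 *+ 9).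
Proof.
rewrite rmorphM rmorphXn /= inflateX.
transitivity (q ^+ 3 * G3 ^+ 3 * G ^+ 3); first by ring.
by rewrite G_cube; move: (V G) => g; ring.
Qed.

(** The cubic relation makes 1/W a quadratic polynomial in W over series in q^3. Hence U s reduces
    to components of W and W^2; the next lemma reduces s^2 to W and s. *)
Lemma inflate2_euler12_s : V (V W) ^+ 2 * s
  = G3 ^+ 4 * (q * W ^+ 2 + q * (q * (V (V W) * W)) *+ 3 + q ^+ 3 * V (V W) ^+ 2 *+ 9).
Proof.
apply: euler12_lreg; apply: inflate2_euler12_lreg.
have := euler12_modular R_torsion2; have := inflate_ratio; have := G_euler12.
move: (V G) W (V W) (V (V W)) => g w C D hC hD h.
transitivity (q * g ^+ 4 * (D * w ^+ 3 + q * D ^+ 2 * w ^+ 2 *+ 3 + q ^+ 2 * D ^+ 3 * w *+ 9));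
  last by ring.
by rewrite h -hD -hC; ring.
Qed.

Lemma inflate2_euler12_s2 : V (V W) * s ^+ 2
  = G3 ^+ 4 * (q * (q * W) + q ^+ 3 * V (V W) *+ 3 + q ^+ 3 * (V (V W) * s) *+ 9).
Proof.
apply: inflate2_euler12_lreg.
have := inflate2_euler12_s; have := inflate_ratio; have := G_euler12.
move: (V G) W (V W) (V (V W)) => g w C D hC hD h.
transitivity (q * G * g * (D ^+ 2 * (q * G * g))); first by ring.
rewrite {}h; transitivity (g ^+ 5 * q ^+ 2 *
  (G * w * w + q * D * (G * w) *+ 3 + q ^+ 2 * D ^+ 2 * G *+ 9)); first by ring.
by rewrite hC -hD; ring.
Qed.

Lemma trisection1_euler12 : U 1 W = - V W.
Proof.
rewrite {1}euler12_trisect // -!mulrN -!rmorphN; exact: trisection_trisect.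
Qed.

(** With C = f3 f6, the component is C^2 - 2 A B, and A B = 2 C^2. *)
Lemma trisection2_euler12_sqr : U 2 (W ^+ 2) = - V W ^+ 2 *+ 3.
Proof.
have ab := euler12_comp02 R.
rewrite {1}euler12_trisect //; move: (euler12_comp0 R) (euler12_comp2 R) (V W) ab => a b C ab.
have -> : (V a - q * V C - q ^+ 2 * V b) ^+ 2 = V (a ^+ 2 + q * (C * b) *+ 2)
    + q * V (q * b ^+ 2 - (a * C) *+ 2) + q ^+ 2 * V (C ^+ 2 - (a * b) *+ 2).
  rewrite !(rmorphXn, rmorphM, rmorphB, rmorphD, rmorphMn, rmorphN) /= inflateX; ring.
by rewrite trisection_trisect //= ab; ring.
Qed.

Lemma trisectionMn i (a : fps R) n : U i (a *+ n) = U i a *+ n.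
Proof. by elim: n => [|n IH]; [apply: fpsP => n | rewrite !mulrS trisectionD IH]. Qed.

(** The three terms of the reduction contribute -3, -3 and 9 times t, after cancelling
    [V W ^+ 2]. *)
Lemma trisection_s : U 0 s = t *+ 3.
Proof.
apply: (@lregX _ _ 2 inflate_euler12_lreg).
have /(congr1 (U 0)) := inflate2_euler12_s.
rewrite -!rmorphXn !trisection_inflateM // 2!trisectionD => ->.
rewrite !trisectionMn [q ^+ 3 * _]mulrC -[q ^+ 3]mulr1 -[q ^+ 3]inflateX.
rewrite !(trisection0_XM, trisectionS_XM) !trisection_inflateM //.
rewrite trisection1 trisection1_euler12 trisection2_euler12_sqr mulr1.
by rewrite !rmorphXn /=; move: (V W) => C; ring.
Qed.

Lemma trisection_s2 : U 0 (s ^+ 2) = t *+ 2 + t ^+ 2 *+ 27.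
Proof.
apply: inflate_euler12_lreg.
have /(congr1 (U 0)) := inflate2_euler12_s2.
rewrite -!rmorphXn !trisection_inflateM // 2!trisectionD => ->.
rewrite !trisectionMn -[q ^+ 3]inflateX.
rewrite !(trisection0_XM, trisectionS_XM) !trisection_inflateM // trisection_s.
rewrite inflateK trisection1_euler12.
by move: (V W) => C; ring.
Qed.

Definition eval_int (a : fps R) (p : {poly int}) : fps R := (map_poly intr p).[a].

Lemma evD a p r : eval_int a (p + r) = eval_int a p + eval_int a r.
Proof. by rewrite /eval_int rmorphD hornerD. Qed.
Lemma evMn a p n : eval_int a (p *+ n) = eval_int a p *+ n.
Proof. by rewrite /eval_int rmorphMn hornerMn. Qed.
Lemma evM a p r : eval_int a (p * r) = eval_int a p * eval_int a r.
Proof. by rewrite /eval_int rmorphM hornerM. Qed.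
Lemma evX a : eval_int a 'X = a.
Proof. by rewrite /eval_int map_polyX hornerX. Qed.
Lemma evXn a n : eval_int a 'X^n = a ^+ n.
Proof. by rewrite /eval_int map_polyXn hornerXn. Qed.
Lemma ev1 a : eval_int a 1 = 1.
Proof. by rewrite /eval_int rmorph1 hornerE. Qed.

Lemma trisection_sX i : U 0 (s ^+ i) = eval_int t (trace_poly i).
Proof.
elim/ltn_ind: i => -[|[|[|i]]] IH.
- by rewrite expr0 trisection1 ev1.
- by rewrite expr1 trisection_s evMn evX.
- by rewrite trisection_s2 evD !evMn evX evXn.
have [i3 i2 i1] : [/\ i < i.+3, i.+1 < i.+3 & i.+2 < i.+3]%N by split; lia.
rewrite trace_polyS3 evM evX 2!evD !evMn -!IH {i3 i2 i1}// -!trisectionMn -!trisectionD.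
rewrite -trisection_inflateM //; congr (U 0).
transitivity (s ^+ i * s ^+ 3); first by rewrite -exprD addn3.
by rewrite s_cube !exprS; ring.
Qed.

(** Since s^(4j+1) is q G t^j times the inflation of G t^j, its U-image is G t^j q U_2(G t^j);
    cancelling against t^(j+1) leaves G^3. Likewise below, s^(4j+3) is G^3 t^j times the inflation
    of q G^3 t^j. *)
Lemma trisection_Gt j : U 2 (G * t ^+ j) = G ^+ 3 * eval_int t (trace_quot (4 * j).+1 j.+1).
Proof.
have := trisection_sX (4 * j).+1.
rewrite {1}(@trace_quotE _ j.+1) ?evM ?evXn; last by lia.
have -> : s ^+ (4 * j).+1 = V (G * t ^+ j) * (q * (G * t ^+ j)).
  by rewrite rmorphM rmorphXn rmorphM rmorphXn /= inflateX exprS exprM !exprMn; ring.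
rewrite trisection_inflateM // trisection0_XM => h.
apply: (@fpsX_lreg R); apply: G_lreg; apply: (@lregX _ _ j (@fpsX_lreg R)).
apply: (@lregX _ _ (4 * j) G_lreg).
move: (U 2 _) (eval_int _ _) h => a e h.
transitivity (G * t ^+ j * (q * a)); first by rewrite exprMn -exprM; ring.
by rewrite h exprS exprMn -exprM; ring.
Qed.

Lemma trisection_G3t j : U 0 (G ^+ 3 * t ^+ j) = G * eval_int t (trace_quot (4 * j).+3 j.+1).
Proof.
have := trisection_sX (4 * j).+3.
rewrite {1}(@trace_quotE _ j.+1) ?evM ?evXn; last by lia.
have -> : s ^+ (4 * j).+3 = V (q * (G ^+ 3 * t ^+ j)) * (G ^+ 3 * t ^+ j).
  by rewrite !(rmorphM, rmorphXn) /= inflateX !exprS exprM !exprMn !expr0 !expr1n; ring.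
rewrite trisection_inflateM // => h.
apply: (@fpsX_lreg R); apply: (@lregX _ _ 3 G_lreg); apply: (@lregX _ _ j (@fpsX_lreg R)).
apply: (@lregX _ _ (4 * j) G_lreg).
move: (U 0 _) (eval_int _ _) h => a e h.
transitivity (q * (G ^+ 3 * t ^+ j) * a); first by rewrite exprMn -exprM; ring.
by rewrite h exprS exprMn -exprM; ring.
Qed.

End ModularU.

(** * Divisibility and iteration *)

(** The slack factor 3 pays for the division by 3 after each extraction of exponents 2 modulo 3. *)
Definition dvd27_coefs (p : {poly int}) : Prop :=
  forall j, (((27 ^ j)%N : int) %| 3 * p`_j)%Z.

Definition trace_step2 (p : {poly int}) : {poly int} :=
  \sum_(j < size p) p`_j *: trace_quot (4 * j).+1 j.+1.

Definition trace_step0 (p : {poly int}) : {poly int} :=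
  \sum_(j < size p) p`_j *: trace_quot (4 * j).+3 j.+1.

Lemma dvd27_coefs1 : dvd27_coefs 1.
Proof. by case=> [|j]; rewrite coef1 //= mulr0. Qed.

(** Valuations add up: 3j - 1 from p and 3(l+j+1) - (4j+2) from the trace polynomial give 2j +
    3l. *)
Lemma trace_step2_coef_dvd p l j : dvd27_coefs p ->
  ((9 ^ j * 27 ^ l)%N%:Z %| p`_j * (trace_quot (4 * j).+1 j.+1)`_l)%Z.
Proof.
move=> /(_ j) gp; rewrite coef_trace_quot.
have := dvdz_mul (trace_poly_dvd (4 * j).+1 (l + j.+1)) gp.
have -> : ((27 ^ (l + j.+1))%N : int) * (27 ^ j)%N =
    (3 ^ (4 * j).+3)%N%:Z * (9 ^ j * 27 ^ l)%N.
  rewrite -!PoszM; congr Posz; rewrite -[27%N]/(3 ^ 3)%N -[9%N]/(3 ^ 2)%N -!expnM -!expnD.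
  by congr (_ ^ _)%N; lia.
have -> : (3 ^ (4 * j).+2)%N%:Z * (trace_poly (4 * j).+1)`_(l + j.+1) * (3 * p`_j)
    = (3 ^ (4 * j).+3)%N%:Z * (p`_j * (trace_poly (4 * j).+1)`_(l + j.+1)).
  by rewrite (expnS 3 (4 * j).+2) PoszM; ring.
by rewrite dvdz_mul2l // eqz_nat expn_eq0.
Qed.

Lemma trace_step2_dvd27 p : dvd27_coefs p -> exists2 r, trace_step2 p = r *+ 3 & dvd27_coefs r.
Proof.
move=> gp; set S := trace_step2 p.
have S27 l : ((27 ^ l)%N%:Z %| S`_l)%Z.
  rewrite /S /trace_step2 coef_sum; apply: rpred_sum => j _; rewrite coefZ.
  by apply: dvdz_trans (trace_step2_coef_dvd l j gp); rewrite PoszM dvdz_mull.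
have S3 l : (3 %| S`_l)%Z.
  case: l => [|l]; last first.
    by apply: dvdz_trans (S27 l.+1); rewrite expnS PoszM dvdz_mulr.
  rewrite /S /trace_step2 coef_sum; apply: rpred_sum => -[j /= _] _; rewrite coefZ.
  case: j => [|j]; last first.
    by apply: dvdz_trans (trace_step2_coef_dvd 0 j.+1 gp); rewrite expnS -mulnA PoszM dvdz_mulr.
  (* For l = j = 0 the factor 3 comes from U s = 3 t. *)
  by rewrite coef_trace_quot /= coefMn coefX dvdz_mull.
have Sr : S = (\poly_(l < size S) (S`_l %/ 3)%Z) *+ 3.
  apply/polyP => l; rewrite coefMn coef_poly; case: ltnP => hl.
    by rewrite -[RHS]mulr_natr -[LHS](divzK (S3 l)).
  by rewrite mul0rn nth_default.
exists (\poly_(l < size S) (S`_l %/ 3)%Z) => // l.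
by rewrite mulrC mulr_natr -coefMn -Sr.
Qed.

Lemma trace_step0_dvd27 p : dvd27_coefs p -> dvd27_coefs (trace_step0 p).
Proof.
move=> gp l; rewrite coef_sum mulr_sumr; apply: rpred_sum => -[j /= _] _.
rewrite coefZ coef_trace_quot; set c := (trace_poly _)`_ _.
have := trace_poly_dvd (4 * j).+3 (l + j.+1); rewrite -/c.
case: j c => [|j] c.
  rewrite addn1 (expnS 27) (_ : 3 ^ _ = 27 * 3)%N // !PoszM -mulrA dvdz_mul2l // => h.
  by rewrite mulrCA dvdz_mull.
move=> /dvdz_mul /(_ (gp j.+1)).
have -> : ((27 ^ (l + j.+2))%N : int) * (27 ^ j.+1)%N =
    (3 ^ (4 * j.+1).+4)%N%:Z * (3 ^ j.*2.+1 * 27 ^ l)%N.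
  rewrite -!PoszM; congr Posz; rewrite -[27%N]/(3 ^ 3)%N -!expnM -!expnD.
  by congr (_ ^ _)%N; lia.
have -> : (3 ^ (4 * j.+1).+4)%N%:Z * c * (3 * p`_j.+1)
    = (3 ^ (4 * j.+1).+4)%N%:Z * (3 * (p`_j.+1 * c)) by ring.
rewrite dvdz_mul2l ?eqz_nat ?expn_eq0 //; apply: dvdz_trans.
by rewrite PoszM dvdz_mull.
Qed.

Section Iteration.
Variable R : comNzRingType.
Hypothesis R_torsion2 : injective (fun a : R => a *+ 2).
Local Notation q := (fpsX R).
Local Notation V := (@inflate R).
Local Notation U := (@trisection R).
Variable G : fps R.
Hypothesis G_euler12 : G * euler12 R = V (euler12 R).
Local Notation t := (q * G ^+ 4).

Lemma evE (a : fps R) p : eval_int a p = \sum_(j < size p) (p`_j)%:~R * a ^+ j.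
Proof.
rewrite /eval_int (@horner_coef_wide _ (size p)) ?size_poly //.
by apply: eq_bigr => j _; rewrite coef_map.
Qed.

Lemma ev_sum (a : fps R) n (c : nat -> int) (p : nat -> {poly int}) :
  eval_int a (\sum_(j < n) c j *: p j) = \sum_(j < n) (c j)%:~R * eval_int a (p j).
Proof.
rewrite /eval_int rmorph_sum horner_sum; apply: eq_bigr => j _.
by rewrite /= map_polyZ hornerZ.
Qed.

Lemma trisection_ev_sum i (b c : fps R) (p : {poly int}) (r : nat -> {poly int}) :
  (i < 3)%N -> (forall j, U i (b * t ^+ j) = c * eval_int t (r j)) ->
  U i (b * eval_int t p) = c * eval_int t (\sum_(j < size p) p`_j *: r j).
Proof.
move=> i3 H; rewrite evE (ev_sum _ _ (fun j => p`_j)) !mulr_sumr.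
rewrite (big_morph (U i) (@trisectionD R i) (_ : U i 0 = 0)); last exact: fpsP.
apply: eq_bigr => j _; rewrite mulrCA -(rmorph_int V) trisection_inflateM //.
by rewrite H rmorph_int mulrCA.
Qed.

(** Each extraction of exponents 2 gains a factor 3, and the following extraction of exponents 0
    keeps the invariant. The half-step is carried along because the next full step starts from
    it. *)
Lemma trisection_iter al :
  (exists2 p, dvd27_coefs p & iter al (U 0 \o U 2) G = (G * eval_int t p) *+ 3 ^ al) /\
  (exists2 p, dvd27_coefs p & U 2 (iter al (U 0 \o U 2) G) = (G ^+ 3 * eval_int t p) *+ 3 ^ al.+1).
Proof.
have step p k : dvd27_coefs p ->
    exists2 r, dvd27_coefs r & U 2 ((G * eval_int t p) *+ 3 ^ k)
      = (G ^+ 3 * eval_int t r) *+ 3 ^ k.+1.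
  move=> /trace_step2_dvd27[r rE gr]; exists r => //.
  rewrite trisectionMn (@trisection_ev_sum 2 G (G ^+ 3) p
    (fun j => trace_quot (4 * j).+1 j.+1)) //; last exact: trisection_Gt.
  by rewrite -/(trace_step2 p) rE evMn mulrnAr -mulrnA -expnS.
elim: al => [|al [_ [p gp IH]]].
  have G1 : G = (G * eval_int t 1) *+ 3 ^ 0 by rewrite ev1 mulr1.
  split; first by exists 1; [exact: dvd27_coefs1 | exact: G1].
  by rewrite /= {1}G1; apply: step; exact: dvd27_coefs1.
have hU : iter al.+1 (U 0 \o U 2) G = (G * eval_int t (trace_step0 p)) *+ 3 ^ al.+1.
  rewrite iterS /= IH trisectionMn; congr (_ *+ _).
  apply: (@trisection_ev_sum 0 (G ^+ 3) G p (fun j => trace_quot (4 * j).+3 j.+1)) => //.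
  exact: trisection_G3t.
have g0 := trace_step0_dvd27 gp.
split; first by exists (trace_step0 p).
by rewrite hU; apply: step.
Qed.

(** For j > 0 the invariant makes the coefficient a multiple of 9. *)
Lemma dvd27_coefs_mod3 p : dvd27_coefs p -> exists r, p = (p`_0)%:P + r *+ 3.
Proof.
move=> gp; exists (\poly_(l < size p) ((p`_l - (p`_0 *+ (l == 0%N))) %/ 3)%Z).
apply/polyP => l; rewrite coefD coefC coefMn coef_poly.
case: l => [|l] /=; first by rewrite mulr1n subrr div0z if_same mul0rn addr0.
rewrite mulr0n subr0 add0r; case: ltnP => hl; last by rewrite mul0rn nth_default.
suff h3 : (3 %| p`_l.+1)%Z by rewrite -[RHS]mulr_natr -[LHS](divzK h3).
have := gp l.+1; rewrite expnS -(mulnA 3 9) PoszM dvdz_mul2l //.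
by apply: dvdz_trans; rewrite -(mulnA 3 3) PoszM dvdz_mulr.
Qed.

(** Modulo 3 both G^3 and the constant left of p(t) are series in q^3, with no exponents congruent
    to 1 or 2. *)
Lemma trisection_G3_mod3 i p : (0 < i < 3)%N -> dvd27_coefs p ->
  exists r, U i (G ^+ 3 * eval_int t p) = r *+ 3.
Proof.
move=> i3 /dvd27_coefs_mod3[r ->].
have [b Gb] : exists b, G ^+ 3 = V G + b *+ 3.
  exists (q * G * V G ^+ 2 + q ^+ 2 * G ^+ 2 * V G ^+ 3 *+ 3).
  by rewrite (G_cube R_torsion2 G_euler12); move: (V G) => ?; ring.
set c := p`_0.
have evc : eval_int t c%:P = V c%:~R by rewrite /eval_int map_polyC hornerC rmorph_int.
exists (U i (b * V c%:~R + G ^+ 3 * eval_int t r)).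
rewrite -trisectionMn evD evMn evc.
have -> : G ^+ 3 * (V c%:~R + eval_int t r *+ 3) =
    V (G * c%:~R) + (b * V c%:~R + G ^+ 3 * eval_int t r) *+ 3.
  by rewrite rmorphM Gb /=; ring.
by rewrite trisectionD trisection_inflate // add0r.
Qed.

(** One step sends the index n to 9n + 2, and 2 (1 + 9 + ... + 9^(al-1)) = (9^al - 1)/4. *)
Lemma coeff_iter_trisection (a : fps R) al n :
  (iter al (U 0 \o U 2) a)$n = a$((3 ^ (2 * al) * n + (3 ^ (2 * al) - 1) %/ 4)%N).
Proof.
elim: al n => [|al IH] n; first by rewrite /= mul1n addn0.
rewrite iterS /= IH; congr (a$_); rewrite mulnS expnD.
have [c ->] : exists c, (3 ^ (2 * al) = 4 * c + 1)%N.
  by exists (3 ^ (2 * al) %/ 4)%N; elim: {IH} al => // al IH; rewrite mulnS expnD; lia.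
by nia.
Qed.

End Iteration.

(** * The theorem *)

Definition fps_of_poly (R : comNzRingType) (p : {poly R}) : fps R := Fps (fun i => p`_i).

Lemma fps_of_polyM (R : comNzRingType) (p r : {poly R}) :
  fps_of_poly (p * r) = fps_of_poly p * fps_of_poly r.
Proof. by apply: fpsP => n; rewrite coeffM /= coefM. Qed.

Lemma fps_of_poly_fk k N : fps_of_poly (fk k N) = qpoch N (- fpsX int ^+ k) (fpsX int ^+ k).
Proof.
elim: N => [|N IH].
  rewrite /fk big_geq // /qpoch big_ord0.
  by apply: fpsP => n; rewrite /= coef1.
rewrite /fk big_nat_recr //= fps_of_polyM qpochS -IH; congr (_ * _).
apply: fpsP => n; rewrite coeffD mulNr coeffN -exprM -exprD -mulnS coeffXn /=.
by rewrite coefB coef1 coefXn.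
Qed.

(** The factors 1 - q^(k m) with m > n are 1 modulo q^(n+1). *)
Lemma qpoch_eqm (R : comNzRingType) k n : (0 < k)%N ->
  eqm n.+1 (qpoch n (- fpsX R ^+ k) (fpsX R ^+ k)) (euler R k).
Proof.
move=> k0; rewrite eulerE.
have [N0 /(_ (n + N0)%N (leq_addl _ _)) h] := cvg_qinf (- fpsX R ^+ k) (coeff0_fpsXn R k0) n.+1.
apply: eqm_trans h; elim: N0 => [|m IH]; first by rewrite addn0.
apply: (eqm_trans IH); rewrite addnS qpochS -[X in eqm _ X _]mulr1.
apply: eqmM => //; rewrite -[X in eqm _ X _]addr0; apply: eqmD => //.
move=> i ni; rewrite mulNr coeffN -exprM -exprD coeffXn.
by rewrite (_ : (i == _) = false) ?oppr0 //; nia.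
Qed.

Lemma is_a3_fps (a : nat -> int) : is_a3 a -> Fps a * euler12 int = inflate (euler12 int).
Proof.
move=> Ha; apply: fpsP => n; rewrite inflate_euler12 euler12.unlock mulrA.
have hf k : (0 < k)%N -> eqm n.+1 (fps_of_poly (fk k n)) (euler int k).
  by move=> k0; rewrite fps_of_poly_fk; apply: qpoch_eqm.
have ha : eqm n.+1 (fps_of_poly (ser a n)) (Fps a).
  by move=> i ni; rewrite /= coef_poly ni.
rewrite -(eqmM (eqmM ha (hf 1%N isT)) (hf 2%N isT)) // -(eqmM (hf 3%N isT) (hf 6%N isT)) //.
by rewrite -!fps_of_polyM; apply: Ha.
Qed.

Theorem theorem1p1 (a3 : nat -> int) (Ha : is_a3 a3) (alpha n : nat) :
  [/\ ((3 ^ alpha)%N%:Z %| a3 (3 ^ (2 * alpha) * n + (3 ^ (2 * alpha) - 1) %/ 4)%N)%Z,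
      ((3 ^ alpha.+1)%N%:Z %| a3 (3 ^ (2 * alpha + 1) * n + (3 ^ (2 * alpha + 2) - 1) %/ 4)%N)%Z,
      ((3 ^ alpha.+2)%N%:Z %| a3 (3 ^ (2 * alpha + 2) * n + (7 * 3 ^ (2 * alpha + 1) - 1) %/ 4)%N)%Z
    & ((3 ^ alpha.+2)%N%:Z %| a3 (3 ^ (2 * alpha + 2) * n + (11 * 3 ^ (2 * alpha + 1) - 1) %/ 4)%N)%Z].
Proof.
have tors : injective (fun x : int => x *+ 2) by move=> x y /=; lia.
have GW := is_a3_fps Ha.
have [[p gp Hp] [r gr Hr]] := trisection_iter tors GW alpha.
have dvdMn (x : int) k : ((3 ^ k)%N%:Z %| x *+ 3 ^ k)%Z.
  by rewrite -mulr_natr natz dvdz_mull.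
(* As 9 is 1 modulo 4, the quotients by 4 in the indices are exact. *)
have [c Nc] : exists c, (3 ^ (2 * alpha) = 4 * c + 1)%N.
  exists (3 ^ (2 * alpha) %/ 4)%N.
  by elim: {Hp Hr} alpha => // al IH; rewrite mulnS expnD; lia.
have a3_2 m : a3 (3 ^ (2 * alpha) * (3 * m + 2) + (3 ^ (2 * alpha) - 1) %/ 4)%N =
    (Fps a3 ^+ 3 * eval_int (fpsX int * Fps a3 ^+ 4) r)$m *+ 3 ^ alpha.+1.
  by rewrite -coeffMn -Hr /= coeff_iter_trisection.
have a3_3 i : (0 < i < 3)%N -> ((3 ^ alpha.+2)%N%:Z %|
    a3 (3 ^ (2 * alpha) * (3 * (3 * n + i) + 2) + (3 ^ (2 * alpha) - 1) %/ 4)%N)%Z.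
  move=> i3; rewrite a3_2.
  have [b hb] := trisection_G3_mod3 tors GW i3 gr.
  have /(congr1 (fun x => x$n)) := hb; rewrite [LHS]/= coeffMn => ->.
  by rewrite -mulrnA -expnS.
split.
- have /(congr1 (fun x => x$n)) := Hp; rewrite coeff_iter_trisection /= coeffMn => ->.
  exact: dvdMn.
(* Here 2 * 9^alpha + (9^alpha - 1)/4 = (9^(alpha+1) - 1)/4. *)
- rewrite [X in a3 X](_ : _ = 3 ^ (2 * alpha) * (3 * n + 2) + (3 ^ (2 * alpha) - 1) %/ 4)%N.
    by rewrite a3_2; apply: dvdMn.
  by rewrite !(expnD _ (2 * alpha)) Nc; nia.
(* The residues i = 1, 2 give 5 and 8 times 9^alpha, and 4 * 5 + 1 = 3 * 7 while 4 * 8 + 1 = 3 *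
   11. *)
- rewrite [X in a3 X](_ : _ =
    3 ^ (2 * alpha) * (3 * (3 * n + 1) + 2) + (3 ^ (2 * alpha) - 1) %/ 4)%N ?a3_3 //.
  by rewrite !(expnD _ (2 * alpha)) Nc; nia.
- rewrite [X in a3 X](_ : _ =
    3 ^ (2 * alpha) * (3 * (3 * n + 2) + 2) + (3 ^ (2 * alpha) - 1) %/ 4)%N ?a3_3 //.
  by rewrite !(expnD _ (2 * alpha)) Nc; nia.
Qed.
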